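(* Let $H\in(0,1)$, $x_0\in\mathbb R$, $\alpha\in(0,1)$ and $\theta_0\in(0,1)$. Consider the fractional Ornstein--Uhlenbeck process $X$ with unknown drift parameter $\theta\in\mathbb R$, and the test of the hypothesis $H_0\colon\theta\ge\theta_0$ against the alternative $H_1\colon\theta\le0$ at significance level $\alpha$ which, for an observation $X_t$ at a time $t>\tilde t_0$, accepts $H_0$ if $g(\theta_0,x_0,t,Z(t))\ge\alpha$ and accepts $H_1$ (rejects $H_0$) otherwise. This test is unbiased, and it is consistent as $t\to\infty$. For the simple alternative $\theta_1\le0$ and time $t>\tilde t_0$, the power of the test equals $g(\theta_1,x_0,t,\tilde c_t)$, where $\tilde c_t\in(0,1)$ is the solution of $g(\theta_0,x_0,t,\tilde c_t)=\alpha$.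
   Context: Let $B^H$ be a fractional Brownian motion with Hurst parameter $H\in(0,1)$ (centered Gaussian, $\mathbf E B^H_tB^H_s=\frac12(|t|^{2H}+|s|^{2H}-|t-s|^{2H})$, continuous modification). The fractional Ornstein--Uhlenbeck process $X$ is the unique solution of $X_t=x_0+\theta\int_0^tX_s\,ds+B^H_t$, $t\ge0$; equivalently $X_t=x_0e^{\theta t}+\theta e^{\theta t}\int_0^te^{-\theta s}B^H_s\,ds+B^H_t$. The test statistic is $Z(t)=\frac{\log^+\log|X_t|}{\log t}$, $t>1$, where $\log^+y=\log y$ if $y>1$ and $\log^+y=0$ otherwise (including $y\le0$ and $y=\log0=-\infty$). For $t\ge1$, $c\ge0$, $\theta\in\mathbb R$, $$g(\theta,x_0,t,c)=\Phi\left(\frac{e^{t^c}-x_0e^{\theta t}}{\sqrt{v(\theta,t)}}\right)+\Phi\left(\frac{e^{t^c}+x_0e^{\theta t}}{\sqrt{v(\theta,t)}}\right)-1,\qquad v(\theta,t)=H\int_0^ts^{2H-1}\left(e^{\theta s}+e^{\theta(2t-s)}\right)ds,$$ with $\Phi$ the standard normal distribution function. The number $\tilde t_0>1$ is a constant such that for every $t>\tilde t_0$ there is a unique $\tilde c_t\in(0,1)$ with $g(\theta_0,x_0,t,\tilde c_t)=\alpha$ (such a constant exists). Terminology: writing $\mathbf P_\theta$ for probability when the true drift is $\theta$, the power at $\theta_1$ is $\mathbf P_{\theta_1}(H_0\text{ is rejected})$. Unbiased (at level $\alpha$) means that the rejection probability is at most $\alpha$ for every $\theta$ in $H_0$ and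 at least $\alpha$ for every $\theta$ in $H_1$. Consistent means that for every fixed $\theta_1$ in $H_1$ the power at $\theta_1$ tends to $1$ as $t\to\infty$. Equality of the power with $g(\theta_1,x_0,t,\tilde c_t)$ is understood using that the law of $Z(t)$ has no atom at $\tilde c_t>0$. *)

(* Defs.v *)
From HB Require Import structures.
From mathcomp Require Import all_boot all_order all_algebra.
From mathcomp Require Import all_classical all_reals all_analysis.

Set Implicit Arguments.
Unset Strict Implicit.
Unset Printing Implicit Defensive.

Import Order.TTheory GRing.Theory Num.Theory.
Import numFieldNormedType.Exports.

Local Open Scope classical_set_scope.
Local Open Scope ring_scope.

(* [normal_prob m 0] is the uniform law on [0, 1] in the library, hence the
   separate case: a degenerate Gaussian law is a Dirac mass. *)
Definition gaussian_law (R : realType) (mu : set R -> \bar R) : Prop :=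
  exists m s : R, forall A : set R, measurable A ->
    mu A = if s == 0 then \d_m A else normal_prob m s A.

(* Joint Gaussianity: every finite linear combination has a Gaussian law. *)
Definition gaussian_process (d : measure_display) (T : measurableType d)
    (R : realType) (P : probability T R) (B : R -> {RV P >-> R}) : Prop :=
  forall (n : nat) (t a : 'I_n -> R), (forall i, 0 <= t i) ->
    gaussian_law (pushforward P (fun w => \sum_(i < n) a i * B (t i) w)).
Arguments gaussian_process {d T R} P B.

(* Processes are indexed by all of [R]; only the times [0 <= t] matter. *)
Record fractional_brownian_motion (d : measure_display) (T : measurableType d)
    (R : realType) (P : probability T R) (H : R) (B : R -> {RV P >-> R}) :
    Prop := {
  fbm_gaussian : gaussian_process P B;
  fbm_centered : forall t, 0 <= t -> 'E_P[B t]%E = 0%:E;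
  fbm_covariance : forall t s, 0 <= t -> 0 <= s ->
    'E_P[(fun w => B t w * B s w)%R]%E =
      (2^-1 * (`|t| `^ (2 * H) + `|s| `^ (2 * H) - `|t - s| `^ (2 * H)))%:E;
  fbm_continuous : forall w, {within `[0, +oo[, continuous (fun t => B t w)}
}.
Arguments fractional_brownian_motion {d T R} P H B.

(* X_t = x0 + theta \int_0^t X_s ds + B_t for every t >= 0, pathwise.  Local
   integrability of the paths is required because [Rintegral] has a junk value
   on non-integrable functions. *)
Record fractional_OU (d : measure_display) (T : measurableType d)
    (R : realType) (x0 theta : R) (B X : R -> T -> R) : Prop := {
  fOU_integrable : forall w t, 0 <= t ->
    lebesgue_measure.-integrable `[0, t] (EFin \o (fun s => X s w));
  fOU_equation : forall w t, 0 <= t ->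
    X t w = x0 + theta * \int[lebesgue_measure]_(s in `[0, t]) X s w + B t w
}.

(* For each true drift [theta], [X theta] is the observed process under
   [P theta].  Both usual set-ups are instances: one probability measure and
   one noise [B] driving all the [X theta] ([P] and [B] constant in [theta]),
   or one observed process under varying measures ([X] constant in [theta]). *)
Definition fOU_model (d : measure_display) (T : measurableType d)
    (R : realType) (H x0 : R) (P : R -> probability T R)
    (B X : forall theta : R, R -> {RV (P theta) >-> R}) : Prop :=
  forall theta : R, fractional_brownian_motion (P theta) H (B theta) /\
    fractional_OU x0 theta (fun t w => B theta t w) (fun t w => X theta t w).
Arguments fOU_model {d T R} H x0 P B X.

Definition Phi (R : realType) (x : R) : R := fine (normal_prob 0 1 `]-oo, x]).

Definition v (R : realType) (H theta t : R) : R :=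
  H * \int[lebesgue_measure]_(s in `[0, t])
        (s `^ (2 * H - 1) * (expR (theta * s) + expR (theta * (2 * t - s)))).

Definition g (R : realType) (H theta x0 t c : R) : R :=
  Phi ((expR (t `^ c) - x0 * expR (theta * t)) / Num.sqrt (v H theta t)) +
  Phi ((expR (t `^ c) + x0 * expR (theta * t)) / Num.sqrt (v H theta t)) - 1.

Definition lnplus (R : realType) (y : R) : R := if 1 < y then ln y else 0.

(* The test statistic as a function of the observed value [x] of X_t.  The
   library's [ln 0 = 0] gives [lnplus (ln 0) = 0], the value obtained from
   log 0 = -oo as well. *)
Definition Zstat (R : realType) (t x : R) : R := lnplus (ln `|x|) / ln t.

Definition acceptance_region (R : realType) (H theta0 x0 alpha t : R) : set R :=
  [set x | alpha <= g H theta0 x0 t (Zstat t x)].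

Definition rejection_region (R : realType) (H theta0 x0 alpha t : R) : set R :=
  ~` acceptance_region H theta0 x0 alpha t.

(* Probability of rejection when the true drift is [theta]. *)
Definition power (d : measure_display) (T : measurableType d) (R : realType)
    (P : R -> probability T R) (X : forall theta : R, R -> {RV (P theta) >-> R})
    (H theta0 x0 alpha t theta : R) : \bar R :=
  P theta [set w | rejection_region H theta0 x0 alpha t (X theta t w)].
Arguments power {d T R} P X H theta0 x0 alpha t theta.

Definition unbiased (R : realType) (alpha : R) (H0 H1 : set R)
    (pow : R -> \bar R) : Prop :=
  (forall theta, H0 theta -> (pow theta <= alpha%:E)%E) /\
  (forall theta, H1 theta -> (alpha%:E <= pow theta)%E).

(* [pow t theta] is the power at [theta] of the test based on time [t]. *)
Definition consistent (R : realType) (H1 : set R) (pow : R -> R -> \bar R) :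
    Prop :=
  forall theta1, H1 theta1 -> pow t theta1 @[t --> +oo%R] --> 1%E.

(* Main.v *)
From HB Require Import structures.
Require Import Defs.
From mathcomp Require Import all_boot all_order all_algebra.
From mathcomp Require Import all_classical all_reals all_analysis.
From mathcomp Require Import measurable_realfun ring lra.

(* Solving the linear equation pathwise gives
     X_t = x0 e^(theta t) + B_t + theta e^(theta t) \int_0^t e^(- theta s) B_s ds.
   The centered part is the pointwise limit of the autoregressive sums
     B_t + q^(-n) (1 - q) \sum_(i < n) q^i B_(i t / n),  q = e^(- theta t / n),
   which are Gaussian and whose variances are computed exactly, by summing
   geometric series; hence X_t is Gaussian, and an integration by parts
   identifies the limit variance with v(theta, t).  Rejection means
   |X_t| < exp(t^c) with c = ctilde t, so the power at theta is
   g(theta, x0, t, c), and everything reduces to g: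
   - g(theta, ...) = P(|b + N| < a) with N standard normal, where
     a = exp(t^c) / sqrt v decreases and |b| = |x0| e^(theta t) / sqrt v
     increases with theta, so g decreases in theta: the test is unbiased;
   - g(theta0, ...) = alpha > 0 bounds a below at theta0, so exp(t^c) is at least
     of order e^(theta0 t / 2) t^H, which dominates the standard deviation t^H
     at theta = 0: the test is consistent. *)

Import Order.TTheory GRing.Theory Num.Theory.
Import numFieldNormedType.Exports.

Local Open Scope classical_set_scope.
Local Open Scope ring_scope.

(** * Gaussian laws and their limits *)

Section gaussian.
Variable R : realType.
Implicit Types m s x y c : R.

(** The identity, seen as a random variable on the space carrying [normal_prob m s], has
    [normal_cdf m s] as its distribution function; the general limits of [cdf] at both infinities
    then apply. *)
Let idR : measurableTypeR R -> R := idfun.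

#[local] HB.instance Definition _ :=
  @isMeasurableFun.Build _ _ _ _ idR (@measurable_id _ _ setT).

Definition normal_cdf m s x : R := fine (normal_prob m s `]-oo, x]).

Lemma is_derive_normal_cdf m s x : s != 0 ->
  is_derive x 1 (normal_cdf m s) (normal_pdf m s x).
Proof.
move=> s0.
have xx : x < x + 1 by rewrite ltrDl.
have /(_ xx) := @continuous_FTC1 R (normal_pdf m s) -oo%O x (x + 1).
have ip : lebesgue_measure.-integrable [set` `]-oo, x + 1]] (EFin \o normal_pdf m s).
  by apply: integrableS (integrable_normal_pdf m s).
move=> /(_ ip) /(_ (ltNyr x)) /(_ (@continuous_normal_pdf R m s s0 x)) [dF F'E].
by apply: DeriveDef => //; rewrite -derive1E.
Qed.

Lemma normal_cdf_cvgy m s : normal_cdf m s x @[x --> +oo%R] --> (1 : R).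
Proof.
have := @cvg_cdfy1 _ _ R (normal_prob m s) (idR : {RV (normal_prob m s) >-> R}).
by move=> /fine_cvg /=; rewrite /cdf /=.
Qed.

Lemma normal_cdf_cvgNy m s : normal_cdf m s x @[x --> -oo%R] --> (0 : R).
Proof.
have := @cvg_cdfNy0 _ _ R (normal_prob m s) (idR : {RV (normal_prob m s) >-> R}).
by move=> /fine_cvg /=; rewrite /cdf /=.
Qed.

Lemma normal_cdf_homo m s : {homo normal_cdf m s : x y / x <= y}.
Proof.
move=> x y xy; rewrite /normal_cdf fine_le ?fin_num_measure//.
by rewrite le_measure ?inE//; exact: subitvPr.
Qed.

Lemma normal_pdf_standardize s m x : 0 < s -> normal_pdf m s x = normal_pdf 0 1 ((x - m) / s) / s.
Proof.
move=> s0; rewrite !normal_pdfE ?gt_eqF// /normal_peak /normal_fun.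
have -> : numfield.Num.Def.sqrtr (s ^+ 2 * pi *+ 2) = Num.sqrt (pi *+ 2) * s :> R.
  by rewrite -mulrnAr sqrtrM ?sqr_ge0// sqrtr_sqr gtr0_norm// mulrC.
rewrite subr0 expr1n mul1r invfM -!mulrA; congr (_ * _).
rewrite mulrC; congr (expR _ * _).
by have := lt0r_neq0 s0; move=> ?; field.
Qed.

Lemma is_derive_Phi x : is_derive x 1 (@Phi R) (normal_pdf 0 1 x).
Proof. exact: (is_derive_normal_cdf 0 1 x (oner_neq0 R)). Qed.

Lemma continuous_Phi : continuous (@Phi R).
Proof.
move=> x; apply: differentiable_continuous; apply/derivable1_diffP.
by case: (is_derive_Phi x).
Qed.

Lemma is_derive_affine m s x : is_derive x 1 (fun y : R => (y - m) / s) s^-1.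
Proof.
have -> : (fun y : R => (y - m) / s) = (s^-1 *: (id - cst m : R -> R)).
  by apply/funext => y; rewrite /= mulrC.
have h : is_derive x 1 (id - cst m : R -> R) (1 - 0 : R) by exact: is_deriveB.
by have := is_deriveZ s^-1 h; rewrite subr0 /GRing.scale /= mulr1.
Qed.

(** The difference of the two sides has zero derivative, so it is constant, and it tends to 0 at
    +oo. *)
Lemma normal_cdf_standardize m s x : 0 < s -> normal_cdf m s x = Phi ((x - m) / s).
Proof.
move=> s0.
pose f : R -> R := normal_cdf m s - (@Phi R \o (fun y : R => (y - m) / s)).
have df y : is_derive y 1 f 0.
  have h := is_derive_normal_cdf m s y (lt0r_neq0 s0).
  have h1 := @is_derive1_comp R (@Phi R) _ y _ _ (is_derive_Phi _) (is_derive_affine m s y).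
  have := is_deriveB h h1.
  by rewrite /f (normal_pdf_standardize s m y s0) subrr.
have fc y : f y = f x by exact: is_derive_0_is_cst.
have f0 : f y @[y --> +oo%R] --> (0 : R).
  rewrite -[X in _ --> X](subrr (1 : R)); apply: cvgB; first exact: normal_cdf_cvgy.
  apply: (@cvg_comp _ _ _ (fun y => (y - m) / s) (@Phi R) _ (+oo%R)); last exact: normal_cdf_cvgy.
  apply: gt0_cvgMly; first by rewrite invr_gt0.
  exact: cvg_addrr.
have : f x = 0.
  by apply: (cvg_unique _ _ f0) => //; rewrite (_ : f = cst (f x)); [exact: cvg_cst|exact/funext].
by rewrite /f => /eqP; rewrite subr_eq0 => /eqP.
Qed.

Lemma normal_pdf01N x : normal_pdf 0 1 (- x) = normal_pdf 0 1 x :> R.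
Proof. by rewrite !normal_pdfE// /normal_fun !subr0 sqrrN. Qed.

(** By evenness of the density, [Phi x + Phi (- x)] has zero derivative; its limit at +oo is 1. *)
Lemma PhiN x : Phi (- x) = 1 - Phi x.
Proof.
pose f : R -> R := (@Phi R) + (@Phi R \o -%R).
have df y : is_derive y 1 f 0.
  have h1 := @is_derive1_comp R (@Phi R) -%R y _ _ (is_derive_Phi _) (is_deriveNid y 1).
  have := is_deriveD (is_derive_Phi y) h1.
  by rewrite normal_pdf01N mulrN1 subrr.
have fc y : f y = f x by exact: is_derive_0_is_cst.
have f0 : f y @[y --> +oo%R] --> (1 : R).
  rewrite -[X in _ --> X]addr0; apply: cvgD; first exact: normal_cdf_cvgy.
  by have := normal_cdf_cvgNy 0 1; rewrite cvgNy_compNP.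
have : f x = 1.
  by apply: (cvg_unique _ _ f0) => //; rewrite (_ : f = cst (f x)); [exact: cvg_cst|exact/funext].
by rewrite /f /= => <-; rewrite addrC addKr.
Qed.

Lemma normal_pdf01_gt0 x : 0 < normal_pdf 0 1 x :> R.
Proof. by rewrite normal_pdfE// mulr_gt0 ?normal_peak_gt0 ?expR_gt0. Qed.

Lemma Phi_mono : {mono (@Phi R) : x y / x < y}.
Proof.
apply/leW_mono/le_mono => x y xy.
have [|z _ /eqP] := MVT xy (fun x _ => is_derive_Phi x).
  by apply: continuous_subspaceT; exact: continuous_Phi.
rewrite subr_eq => /eqP ->.
by rewrite ltrDr mulr_gt0 ?subr_gt0 ?normal_pdf01_gt0.
Qed.

Lemma Phi0 : Phi 0 = 2^-1 :> R.
Proof. by have := PhiN 0; rewrite oppr0 => /eqP; lra. Qed.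
Lemma is_derive_normal_pdf01 x :
  is_derive x 1 (normal_pdf 0 1 : R -> R) (- (x * normal_pdf 0 1 x)).
Proof.
rewrite normal_pdfE// /normal_fun.
have h1 : is_derive x 1 (fun y : R => - (y - 0) ^+ 2 / (1 ^+ 2 *+ 2)) (- x).
  have -> : (fun y : R => - (y - 0) ^+ 2 / (1 ^+ 2 *+ 2)) =
    ((- 2^-1) *: ((id : R -> R) * id) : R -> R).
    apply/funext => y; rewrite subr0 expr1n.
    by change (- y ^+ 2 / 2 = - 2^-1 * (y * y)); field.
  have h2 : is_derive x 1 ((id : R -> R) * id) (x *: 1 + x *: (1:R)) by exact: is_deriveM.
  apply: is_derive_eq (is_deriveZ (- 2^-1) h2) _.
  by rewrite /GRing.scale /=; field.
have h2 := is_derive1_comp (is_derive_expR _) h1.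
apply: is_derive_eq (is_deriveZ (normal_peak 1) h2) _.
rewrite /GRing.scale /=; ring.
Qed.

Lemma mul_normal_pdf01_le x : 0 < x -> x * normal_pdf 0 1 x <= (2 * normal_peak 1) / x.
Proof.
move=> x0; rewrite normal_pdfE// /normal_fun subr0 expr1n.
rewrite ler_pdivlMr// mulrC !mulrA -expr2 mulrAC ler_pM2r ?normal_peak_gt0//.
rewrite mulNr expRN -ler_pdivlMr ?invr_gt0 ?expR_gt0// invrK.
have := expR_ge1Dx (x ^+ 2 / 2); nra.
Qed.

Lemma mul_normal_pdf01_cvgy : x * normal_pdf 0 1 x @[x --> +oo%R] --> (0 : R).
Proof.
apply: (@squeeze_cvgr _ _ _ _ (fun=> 0) (fun x => (2 * normal_peak 1) * x^-1)).
- near=> x; have x0 : 0 < x by near: x; exact: nbhs_pinfty_gt.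
  by rewrite mul_normal_pdf01_le// mulr_ge0// ltW// normal_pdf01_gt0.
- exact: cvg_cst.
- rewrite -[X in _ --> X](mulr0 (2 * normal_peak 1)); apply: cvgM; first exact: cvg_cst.
  apply/gtr0_cvgV0; last exact: cvg_id.
  exact: nbhs_pinfty_gt.
Unshelve. all: by end_near. Qed.

Lemma normal_pdf01_cvgy : normal_pdf 0 1 x @[x --> +oo%R] --> (0 : R).
Proof.
apply: (@squeeze_cvgr _ _ _ _ (fun=> 0) (fun x => x * normal_pdf 0 1 x)).
- near=> x; have x0 : 1 <= x by near: x; exact: nbhs_pinfty_ge.
  by rewrite ler_peMl// ltW// normal_pdf01_gt0.
- exact: cvg_cst.
- exact: mul_normal_pdf01_cvgy.
Unshelve. all: by end_near. Qed.

Lemma half_second_moment (a s : R) :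
  (\int[lebesgue_measure]_(z in `[0%R, +oo[) ((a + s * z) ^+ 2 * normal_pdf 0 1 z)%:E =
    ((a ^+ 2 + s ^+ 2) / 2 + 2 * a * s * normal_pdf 0 1 0)%:E)%E.
Proof.
(* An explicit antiderivative of the integrand, found from the fact that the standard density f
   satisfies f'(z) = - z f(z). *)
pose A : R -> R := (((a ^+ 2 + s ^+ 2) *: @Phi R) - ((2 * a * s) *: normal_pdf 0 1))
   - s ^+ 2 *: ((id : R -> R) * normal_pdf 0 1).
have dA x : is_derive x 1 A ((a + s * x) ^+ 2 * normal_pdf 0 1 x).
  have h1 := is_deriveM (is_derive_id x 1) (is_derive_normal_pdf01 x).
  apply: is_derive_eq (is_deriveB (is_deriveB (is_deriveZ (a ^+ 2 + s ^+ 2) (is_derive_Phi x))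
    (is_deriveZ (2 * a * s) (is_derive_normal_pdf01 x))) (is_deriveZ (s ^+ 2) h1)) _.
  by rewrite /GRing.scale /=; ring.
rewrite (@ge0_continuous_FTC2y R _ A 0 (a ^+ 2 + s ^+ 2)).
- rewrite -EFinD; congr EFin; rewrite /A.
  change (a ^+ 2 + s ^+ 2 - ((a ^+ 2 + s ^+ 2) * Phi 0 - (2 * a * s) * normal_pdf 0 1 0 -
    s ^+ 2 * (0 * normal_pdf 0 1 0)) = (a ^+ 2 + s ^+ 2) / 2 + 2 * a * s * normal_pdf 0 1 0).
  by rewrite Phi0; field.
- by move=> x _; rewrite mulr_ge0 ?sqr_ge0// ltW// normal_pdf01_gt0.
- apply: continuous_subspaceT => x; apply: cvgM; last exact: continuous_normal_pdf.
  apply: cvgM; (apply: cvgD; [exact: cvg_cst|apply: cvgM; [exact: cvg_cst|exact: cvg_id]]).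
- rewrite [X in _ --> X](_ : _ =
    ((a ^+ 2 + s ^+ 2) * 1 - (2 * a * s) * 0) - s ^+ 2 * 0); last by ring.
  apply: cvgB; first apply: cvgB.
  + by apply: cvgM; [exact: cvg_cst|exact: normal_cdf_cvgy].
  + by apply: cvgM; [exact: cvg_cst|exact: normal_pdf01_cvgy].
  + by apply: cvgM; [exact: cvg_cst|exact: mul_normal_pdf01_cvgy].
- by move=> x _; case: (dA x).
- apply: cvg_at_right_filter; apply: differentiable_continuous; apply/derivable1_diffP.
  by case: (dA 0).
- by move=> x _; rewrite derive1E; have := dA x => dx; rewrite derive_val.
Qed.

(** Reflecting the negative half-line replaces s by - s, so the boundary terms 2 a s f(0) of the two
    halves cancel, f being the standard density. *)
Lemma second_moment_affine (a s : R) :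
  (\int[lebesgue_measure]_z ((a + s * z) ^+ 2 * normal_pdf 0 1 z)%:E =
    (a ^+ 2 + s ^+ 2)%:E)%E.
Proof.
have cont b c : continuous (fun z : R => (b + c * z) ^+ 2 * normal_pdf 0 1 z).
  move=> x; apply: cvgM; last exact: continuous_normal_pdf.
  apply: cvgM; (apply: cvgD; [exact: cvg_cst|apply: cvgM; [exact: cvg_cst|exact: cvg_id]]).
have ge0 b c x : 0 <= (b + c * x) ^+ 2 * normal_pdf 0 1 x.
  by rewrite mulr_ge0 ?sqr_ge0// ltW// normal_pdf01_gt0.
have mf b c : measurable_fun setT (fun z : R => (b + c * z) ^+ 2 * normal_pdf 0 1 z).
  exact: continuous_measurable_fun.
rewrite -(setUv `]-oo, 0%R[) ge0_integral_setU//=; last 4 first.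
- exact: measurableC.
- by apply/measurable_EFinP; rewrite setUv; exact: mf.
- by move=> x _; rewrite lee_fin.
- exact/disj_setPCl.
rewrite setCitvl half_second_moment.
rewrite integral_itv_bndo_bndc; last exact/measurable_EFinP/measurable_funTS.
have := @ge0_integration_by_substitutionNy R
  (fun z => (a + s * z) ^+ 2 * normal_pdf 0 1 z) 0.
rewrite oppr0 => -> //; last by apply: continuous_subspaceT; exact: cont.
under eq_integral => x _ do rewrite /= normal_pdf01N mulrN -mulNr.
by rewrite half_second_moment -EFinD sqrrN; congr EFin; field.
Qed.

(** The Radon-Nikodym derivative of the normal law agrees almost everywhere with [normal_pdf], since
    both have the same integral over every measurable set. *)
Lemma ge0_integral_normal_prob (m s : R) (f : R -> R) : s != 0 ->
  measurable_fun setT f -> (forall x, 0 <= f x) ->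
  (\int[normal_prob m s]_x (f x)%:E =
   \int[lebesgue_measure]_x (f x * normal_pdf m s x)%:E)%E.
Proof.
move=> s0 mf f0; have dom := normal_prob_dominates m s.
have mF : measurable_fun [set: measurableTypeR R] (EFin \o f) by exact/measurable_EFinP.
rewrite -(Radon_Nikodym_SigmaFinite.change_of_variables dom)//; last first.
have iRN := Radon_Nikodym_SigmaFinite.f_integrable dom.
have mpdf := measurable_normal_pdf m s.
apply: ge0_ae_eq_integral => //.
- by apply: emeasurable_funM => //; exact: (measurable_int _ iRN).
- by apply/measurable_EFinP; exact: measurable_funM.
- by move=> x _; rewrite mule_ge0// ?lee_fin// Radon_Nikodym_SigmaFinite.f_ge0.
- by move=> x _; rewrite lee_fin mulr_ge0// normal_pdf_ge0.
- under [X in ae_eq _ _ _ X]eq_fun do rewrite EFinM.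
  apply: ae_eqe_mul2l.
  apply: integral_ae_eq => //.
  + by apply/measurable_EFinP.
  + by move=> E _ mE; rewrite -Radon_Nikodym_SigmaFinite.f_integral.
Qed.

Lemma normal_second_moment (m s c : R) : 0 < s ->
  (\int[normal_prob m s]_x ((x + c) ^+ 2)%:E = ((m + c) ^+ 2 + s ^+ 2)%:E)%E.
Proof.
move=> s0; have sn0 := lt0r_neq0 s0.
have contG : continuous (fun x : R => (x + c) ^+ 2).
  by move=> x; apply: cvgM; (apply: cvgD; [exact: cvg_id|exact: cvg_cst]).
rewrite ge0_integral_normal_prob//; last 2 first.
- exact: continuous_measurable_fun.
- by move=> x; exact: sqr_ge0.
(* The substitution x = m + s z, written as a shift followed by a scaling so that its limits at
   infinity are immediate. *)
pose F (z : R) : R := (z + m / s) * s.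
have FE z : F z = m + s * z by rewrite /F; field.
have dF (z : R) : is_derive z 1 F s.
  rewrite (_ : F = cst m + s *: (id : R -> R)); last exact/funext.
  have h := is_deriveD (is_derive_cst m z 1) (is_deriveZ s (is_derive_id z 1)).
  by apply: is_derive_eq h _; rewrite add0r /GRing.scale /= mulr1.
have F' : F^`()%classic = cst s.
  by apply/funext => z; rewrite derive1E; have := dF z => dx; rewrite derive_val.
rewrite (@increasing_ge0_integration_by_substitutionT R F).
- rewrite -second_moment_affine; apply: eq_integral => z _; congr EFin.
  change ((F z + c) ^+ 2 * normal_pdf m s (F z) * F^`()%classic z =
    (m + c + s * z) ^+ 2 * normal_pdf 0 1 z).
  rewrite F' normal_pdf_standardize// FE /= (_ : (m + s * z - m) / s = z); last by field.
  by field.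
- by move=> x y xy; rewrite !FE ltrD2l ltr_pM2l.
- by rewrite F' => x; exact: cvg_cst.
- by rewrite F'; exact: is_cvg_cst.
- by rewrite F'; exact: is_cvg_cst.
- by move=> x; case: (dF x).
- by apply: gt0_cvgMlNy => //; exact: cvg_addrr_Ny.
- by apply: gt0_cvgMly => //; exact: cvg_addrr.
- by move=> x; apply: cvgM; [exact: contG|exact: continuous_normal_pdf].
- by move=> x; rewrite mulr_ge0 ?sqr_ge0 ?normal_pdf_ge0.
Qed.

(** The scale in [gaussian_law] has no prescribed sign; the density depends only on its square, so
    the scale may be taken positive. *)
Lemma normal_pdf_norm m s : normal_pdf m `|s| = normal_pdf m s :> (R -> R).
Proof.
have E : `|s| ^+ 2 = s ^+ 2 by rewrite real_normK ?num_real.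
by rewrite /normal_pdf normr_eq0 /normal_peak /normal_fun E.
Qed.

Lemma normal_prob_norm m s : normal_prob m `|s| = normal_prob m s :> (set R -> \bar R).
Proof. by apply/funext => A; rewrite /normal_prob normal_pdf_norm. Qed.

End gaussian.

Section gaussian_law_cdf.
Context d (T : measurableType d) (R : realType) (P : probability T R).

Lemma expectation_sqrD (Y : {RV P >-> R}) (c : R) :
  (Y : T -> R) \in Lfun P 2%:E -> 'E_P[Y]%E = 0%E ->
  ('E_P[(fun w => (Y w + c) ^+ 2)%R] = 'E_P[(fun w => (Y w) ^+ 2)%R] + (c ^+ 2)%:E)%E.
Proof.
move=> Y2 EY.
have Y1 : (Y : T -> R) \in Lfun P 1 by apply: Lfun_subset12 Y2; rewrite fin_num_measure.
have YY : (fun w => Y w ^+ 2) \in Lfun P 1 by exact: (Lfun2_mul_Lfun1 Y2 Y2).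
have cY : ((2 * c) \o* (Y : T -> R)) \in Lfun P 1 by apply: Lfun_scale => //; exact: lexx.
have c1 : cst (c ^+ 2) \in Lfun P 1 by exact: Lfun_cst.
rewrite (_ : (fun w => (Y w + c) ^+ 2) =
    ((fun w => Y w ^+ 2) \+ ((2 * c) \o* (Y : T -> R))) \+ cst (c ^+ 2)); last first.
  by apply/funext => w /=; ring.
rewrite expectationD//; last by rewrite rpredD.
rewrite expectationD// expectationZl// EY mule0 adde0 expectation_cst //.
Qed.

Lemma gaussian_law_cdf (Y : {RV P >-> R}) (V x : R) :
  gaussian_law (pushforward P Y) -> (Y : T -> R) \in Lfun P 2%:E ->
  'E_P[Y]%E = 0%E -> 'E_P[(fun w => (Y w) ^+ 2)%R]%E = V%:E -> 0 < V ->
  P [set w | Y w <= x] = (Phi (x / Num.sqrt V))%:E.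
Proof.
move=> [m [s law]] Y2 EY EYY V0.
have mY : measurable_fun setT (Y : T -> measurableTypeR R) by exact: (measurable_funPT Y).
(* The same function with the codomain on which [normal_prob] is a measure, so that integrals
   against the two laws can be compared. *)
have [Y' Y'E] : exists Y' : {mfun T >-> measurableTypeR R}, (Y' : T -> R) = Y.
  pose Z : {mfun T >-> measurableTypeR R} := HB.pack (Y : T -> measurableTypeR R)
    (isMeasurableFun.Build _ _ _ _ _ mY).
  by exists Z.
(* The moments of order 2 of [Y + c], for c = 0 and c = 1, determine the
   parameters of the law of [Y]. *)
have Ec c : (\int[distribution P Y']_y ((y + c) ^+ 2)%:E)%E = (V + c ^+ 2)%:E.
  rewrite EFinD -EYY -expectation_sqrD// unlock.
  rewrite ge0_integral_distribution.
  - by apply: eq_integral => w _ /=; rewrite Y'E.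
  - apply/measurable_EFinP; apply: measurable_funX.
    by apply: measurable_funD => //; exact: measurable_id.
  - by move=> y; rewrite lee_fin sqr_ge0.
have [s0|s0] := eqVneq s 0.
  have E c : V + c ^+ 2 = (m + c) ^+ 2.
    apply: EFin_inj; rewrite -Ec.
    rewrite (@eq_measure_integral _ _ _ _ \d_(m : measurableTypeR R)); last first.
      by move=> A mA _ /=; rewrite /distribution Y'E; have := law A mA; rewrite s0 eqxx.
    rewrite integral_dirac//=; last first.
      apply/measurable_EFinP; apply: measurable_funX.
      by apply: measurable_funD => //; exact: measurable_id.
    by rewrite diracE mem_set// mul1e.
  have m0 : m = 0 by have := E 0; have := E 1; lra.
  by exfalso; have := E 0; rewrite m0 addr0 expr0n/= addr0 => V00; rewrite V00 ltxx in V0.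
have s0' : 0 < `|s| by rewrite normr_gt0.
have E c : V + c ^+ 2 = (m + c) ^+ 2 + s ^+ 2.
  apply: EFin_inj; rewrite -Ec.
  transitivity (\int[normal_prob m `|s|]_y ((y + c) ^+ 2)%:E)%E; last first.
    by rewrite normal_second_moment// real_normK ?num_real.
  apply: eq_measure_integral.
  move=> A mA _ /=; rewrite normal_prob_norm /distribution Y'E.
  by have := law A mA; rewrite (negbTE s0).
have [m0 sV] : m = 0 /\ s ^+ 2 = V.
  have m0 : m = 0 by have := E 0; have := E 1; lra.
  by split => //; have := E 0; rewrite m0 !addr0 expr0n/= add0r addr0.
rewrite -sV sqrtr_sqr -[x in Phi (x / _)]subr0 -normal_cdf_standardize//.
have mx : measurable (`]-oo, x]%classic : set R) by exact: measurable_itv.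
have := law _ mx; rewrite (negbTE s0) m0 /normal_cdf normal_prob_norm => <-.
have -> : [set w | Y w <= x] = Y @^-1` `]-oo, x].
  by apply/seteqP; split => w /=; rewrite in_itv/=.
by rewrite fineK// fin_num_measure//; exact: measurable_funPTI.
Qed.
End gaussian_law_cdf.

Section gaussian_limit.
Context d (T : measurableType d) (R : realType) (P : probability T R).

(** Fatou's lemma for events: A lies in the increasing union of the tail intersections [D N], and
    [P (D N)] is at most [P (E N)]. *)
Lemma measure_eventually_le (A : set T) (E : nat -> set T) (p : nat -> R) (l : R) :
  measurable A -> (forall n, measurable (E n)) ->
  (forall w, A w -> \forall n \near \oo, E n w) ->
  (\forall n \near \oo, P (E n) = (p n)%:E) -> p n @[n --> \oo] --> l ->
  (P A <= l%:E)%E.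
Proof.
move=> mA mE AE PE pl.
pose D N := \bigcap_n E (N + n)%N.
have mD N : measurable (D N) by apply: bigcap_measurable => // k _.
have mUD : measurable (\bigcup_N D N) by exact: bigcup_measurable.
have ndD : nondecreasing_seq D.
  move=> m n mn; apply/subsetPset => w Dw k _.
  by have := Dw (n - m + k)%N I; rewrite addnA subnKC.
have PD := @nondecreasing_cvg_mu _ _ _ P D mD mUD ndD.
apply: (@le_trans _ _ (P (\bigcup_N D N))).
  apply: le_measure; rewrite ?inE// => w /AE[N _ NE].
  by exists N => // k _; apply: NE => /=; exact: leq_addr.
have pE : (p n)%:E @[n --> \oo] --> l%:E by apply: cvg_EFin => //; exact: nearW.
apply: (lee_cvg_to PD pE); near=> n.
rewrite -[leRHS](_ : P (E n) = _); last by near: n.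
apply: le_measure; rewrite ?inE// => w /(_ 0%N I).
by rewrite addn0.
Unshelve. all: by end_near.
Qed.

(** If Y <= x < y then eventually Yn <= y, which bounds P(Y <= x) by Phi(y / sqrt V); y decreases to
    x. The mirror argument bounds P(x <= Y). The two bounds meet, which also shows that the limit
    law has no atom. *)
Lemma gaussian_limit (Yn : nat -> {RV P >-> R}) (Y : {RV P >-> R}) (Vn : nat -> R) (V x : R) :
  (forall w, Yn n w @[n --> \oo] --> Y w) ->
  (forall n x, 0 < Vn n -> P [set w | Yn n w <= x] = (Phi (x / Num.sqrt (Vn n)))%:E) ->
  Vn n @[n --> \oo] --> V -> 0 < V ->
  P [set w | Y w < x] = (Phi (x / Num.sqrt V))%:E /\
  P [set w | Y w <= x] = (Phi (x / Num.sqrt V))%:E.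
Proof.
move=> YnY PYn VnV V0.
have nV0 : \forall n \near \oo, 0 < Vn n by exact: (cvgr_gt V).
have cPhi y : Phi (y / Num.sqrt (Vn n)) @[n --> \oo] --> Phi (y / Num.sqrt V).
  apply: continuous_cvg; first exact: continuous_Phi.
  apply: cvgM; first exact: cvg_cst.
  apply: cvgV; first by rewrite gt_eqF// sqrtr_gt0.
  by apply: continuous_cvg VnV; exact: sqrt_continuous.
have cPhi' (F : set_system R) (FF : Filter F) : F --> x ->
    Phi (y / Num.sqrt V) @[y --> F] --> Phi (x / Num.sqrt V).
  move=> Fx; apply: continuous_cvg; first exact: continuous_Phi.
  by apply: cvgM => //; exact: cvg_cst.
have mle (Z : {RV P >-> R}) y : measurable [set w | Z w <= y].
  rewrite (_ : [set w | Z w <= y] = Z @^-1` `]-oo, y]).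
    exact: measurable_funPTI.
  by apply/seteqP; split => w /=; rewrite in_itv/=.
have mlt (Z : {RV P >-> R}) y : measurable [set w | Z w < y].
  rewrite (_ : [set w | Z w < y] = Z @^-1` `]-oo, y[).
    exact: measurable_funPTI.
  by apply/seteqP; split => w /=; rewrite in_itv/=.
have up : (P [set w | (Y w <= x)%R] <= (Phi (x / Num.sqrt V))%:E)%E.
  rewrite -[leLHS]fineK ?fin_num_measure// lee_fin.
  apply: (cvgr_to_ge (cPhi' x^'+ _ _)).
    exact: cvg_at_right_filter.
  near=> y.
  rewrite -lee_fin fineK ?fin_num_measure//.
  apply: (@measure_eventually_le _ (fun n => [set w | Yn n w <= y])
    (fun n => Phi (y / Num.sqrt (Vn n)))) => //.
  - move=> w /= Ywx; have : Y w < y by apply: le_lt_trans Ywx _; near: y; exact: nbhs_right_gt.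
    by move=> Ywy; near=> n; apply: ltW; near: n; exact: (cvgr_lt (Y w)).
  - by near=> n; apply: PYn; near: n.
have lo : (P [set w | (x <= Y w)%R] <= (1 - Phi (x / Num.sqrt V))%:E)%E.
  have mA : measurable [set w | x <= Y w].
    rewrite (_ : [set w | x <= Y w] = ~` [set w | Y w < x]).
      exact: measurableC.
    by apply/seteqP; split => w /=; rewrite leNgt => /negP.
  rewrite -[leLHS]fineK ?fin_num_measure// lee_fin.
  have c1 : 1 - Phi (y / Num.sqrt V) @[y --> x^'-] --> 1 - Phi (x / Num.sqrt V).
    by apply: cvgB; [exact: cvg_cst|apply: cPhi'; exact: cvg_at_left_filter].
  apply: (cvgr_to_ge c1).
  near=> y.
  rewrite -lee_fin fineK ?fin_num_measure//.
  apply: (@measure_eventually_le _ (fun n => ~` [set w | Yn n w <= y])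
    (fun n => 1 - Phi (y / Num.sqrt (Vn n)))) => //.
  - by move=> n; exact: measurableC.
  - move=> w /= Ywx; have : y < Y w by apply: lt_le_trans Ywx; near: y; exact: nbhs_left_lt.
    move=> Ywy; near=> n; apply/negP; rewrite -ltNge; near: n; exact: (cvgr_gt (Y w)).
  - near=> n; rewrite probability_setC// PYn -?EFinB//; near: n; exact: nV0.
  - by apply: cvgB => //; exact: cvg_cst.
have lo' : ((Phi (x / Num.sqrt V))%:E <= P [set w | (Y w < x)%R])%E.
  have : P (~` [set w | Y w < x]) = P [set w | x <= Y w].
    by congr (P _); apply/seteqP; split => w /=; rewrite leNgt => /negP.
  rewrite probability_setC//; move: lo => /[swap] <-.
  rewrite -[P _]fineK ?fin_num_measure// -EFinB !lee_fin; lra.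
have lele : (P [set w | (Y w < x)%R] <= P [set w | (Y w <= x)%R])%E.
  by apply: le_measure; rewrite ?inE// => w /=; exact: ltW.
split; apply/eqP; rewrite eq_le ?up ?lo' ?andbT/=.
- exact: le_trans up.
- exact: le_trans lele.
Unshelve. all: by end_near. Qed.
End gaussian_limit.

(** * Riemann sums *)

Section riemann_sums.
Variable R : realType.
Implicit Types (f : R -> R) (t x : R).

Lemma continuous_integrable_itv f a b : continuous f ->
  lebesgue_measure.-integrable `[a, b] (EFin \o f).
Proof.
move=> cf; apply: continuous_compact_integrable; first exact: segment_compact.
exact: continuous_subspaceT.
Qed.

(** Heine's theorem, from the near-covering form of compactness. Only x is confined to the
    interval. *)
Lemma continuous_uniform_itv f a b (e : R) : continuous f -> 0 < e ->
  exists2 r, 0 < r & forall x y, a <= x <= b -> `|x - y| < r -> `|f x - f y| < e.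
Proof.
move=> cf e0.
have /compact_near_coveringP := @segment_compact R a b.
move=> /(_ R (0^'+) (fun r x => forall y, `|x - y| < r -> `|f x - f y| < e)).
case.
- move=> x _.
  have e2 : 0 < e / 2 by rewrite divr_gt0.
  have /cvgrPdist_lt /(_ _ e2) [r /= r0 rf] := cf x.
  exists (ball x (r / 2), [set z | z < r / 2]).
    split; first by apply: nbhsx_ballx; rewrite divr_gt0.
    exact: nbhs_right_lt (divr_gt0 _ _).
  move=> [y z] /= [xy zr] u yu.
  rewrite (le_lt_trans (ler_distD (f x) _ _))//.
  rewrite [ltRHS](splitr e) ltrD//.
    rewrite distrC; apply: rf => /=; apply: lt_trans xy _.
    by rewrite ltr_pdivrMr// ltr_pMr// ltr1n.
  apply: rf => /=; rewrite (le_lt_trans (ler_distD y _ _))//.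
  by rewrite [ltRHS](splitr r) ltrD//; exact: lt_trans zr.
- move=> r /= r0 rf.
  exists (r / 2); first by rewrite divr_gt0.
  move=> x y xab xy.
  apply: (rf (r / 2)) => //=.
  + by rewrite sub0r normrN gtr0_norm ?divr_gt0// ltr_pdivrMr// ltr_pMr// ltr1n.
  + by rewrite divr_gt0.
Qed.
Lemma is_derive_primitive f x : continuous f -> 0 < x ->
  is_derive x 1 (fun y => \int[lebesgue_measure]_(s in `[0, y]) f s) (f x).
Proof.
move=> cf x0.
have xx : x < x + 1 by rewrite ltrDl.
have [dF F'E] := continuous_FTC1_closed xx (@continuous_integrable_itv f 0 (x + 1) cf) x0 (cf x).
by apply: DeriveDef => //; rewrite -derive1E.
Qed.

Lemma continuous_primitive f t : continuous f -> 0 <= t ->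
  {within `[0, t], continuous (fun y => \int[lebesgue_measure]_(s in `[0, y]) f s)}.
Proof.
move=> cf t0; apply: parameterized_integral_continuous => //.
exact: continuous_integrable_itv.
Qed.

(** The mean value theorem for the primitive turns the integral over each cell into h f(c); by
    uniform continuity each cell then errs by at most h e / t, and the n + 1 cells together by at
    most e. *)
Lemma riemann_sum_cvg f t : continuous f -> 0 < t ->
  \sum_(i < n.+1) (t / n.+1%:R) * f (i%:R * (t / n.+1%:R)) @[n --> \oo] -->
  \int[lebesgue_measure]_(s in `[0, t]) f s.
Proof.
move=> cf t0; apply/cvgrPdist_le => e e0.
have et0 : 0 < e / t by rewrite divr_gt0.
have [r r0 rf] := @continuous_uniform_itv f 0 t _ cf et0.
near=> n.
set h := t / n.+1%:R.
have h0 : 0 < h by rewrite divr_gt0// ltr0n.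
have hr : h < r.
  rewrite /h ltr_pdivrMr ?ltr0n// mulrC -ltr_pdivrMr//.
  apply: (@lt_le_trans _ _ n%:R); last by rewrite ler_nat.
  by near: n; exact: nbhs_infty_gtr.
pose F y := \int[lebesgue_measure]_(s in `[0, y]) f s.
have Ft : F t = \sum_(i < n.+1) (F (i.+1%:R * h) - F (i%:R * h)).
  have := telescope_sumr (fun i => F (i%:R * h)) (leq0n n.+1).
  rewrite big_mkord => ->.
  rewrite mul0r /F set_itv1 Rintegral_set1 subr0 /h mulrC divfK//.
have FB : F t - \sum_(i < n.+1) h * f (i%:R * h) =
    \sum_(i < n.+1) (F (i.+1%:R * h) - F (i%:R * h) - h * f (i%:R * h)).
  by rewrite Ft -sumrB.
rewrite [leLHS](_ : _ = `|F t - \sum_(i < n.+1) h * f (i%:R * h)|)// FB.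
apply: le_trans (ler_norm_sum _ _ _) _.
apply: (@le_trans _ _ (\sum_(i < n.+1) h * (e / t))); last first.
  rewrite sumr_const card_ord -mulr_natl /h (_ : n.+1%:R * (t / n.+1%:R * (e / t)) = e)//.
  by field; rewrite (gt_eqF t0)/= addrC natr1 pnatr_eq0.
apply: ler_sum => i _.
have ih0 : 0 <= i%:R * h by rewrite mulr_ge0// ltW.
have iht : i.+1%:R * h <= t.
  rewrite /h mulrCA ger_pMr// ler_pdivrMr ?ltr0n// mul1r ler_nat.
  exact: ltn_ord.
have ii : i%:R * h < i.+1%:R * h by rewrite ltr_pM2r// ltr_nat.
have [c|c|c cab ->] := @MVT R F f _ _ ii.
- rewrite in_itv/= => /andP[ic _]; apply: is_derive_primitive => //.
  exact: le_lt_trans ic.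
- apply: (@continuous_subspaceW _ _ _ `[0, t]); last first.
    by apply: continuous_primitive => //; exact: ltW.
  by apply: subset_itvScc; rewrite bnd_simp.
move: cab; rewrite in_itv/= => /andP[ic ci].
have -> : i.+1%:R * h - i%:R * h = h by rewrite -mulrBl -natrB// subSnn mul1r.
rewrite [f c * h]mulrC -mulrBr normrM gtr0_norm// ler_pM2l//.
apply/ltW/rf.
  by rewrite (le_trans ih0 (ltW ic)) (le_trans (ltW ci) iht).
rewrite ger0_norm ?subr_ge0 ?(ltW ic)//; apply: lt_trans hr.
rewrite ltrBlDr (lt_le_trans ci)//.
by rewrite -natr1 mulrDl mul1r addrC.
Unshelve. all: by end_near. Qed.

End riemann_sums.

(** * Variance of the autoregressive sums *)

Section discrete_variance.
Variables (R : realFieldType) (q a : R) (w : nat -> R).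
Hypotheses (aq : a * q = 1) (q1 : 1 + q != 0) (w0 : w 0%N = 0).

(** This is |i - j|: at least one of the truncated differences is 0. *)
Let dist (i j : nat) := (i - j + (j - i))%N.

Lemma geometric_sum n : (1 - q) * (\sum_(i < n) q ^+ i) = 1 - q ^+ n.
Proof.
elim: n => [|n IH]; first by rewrite big_ord0 expr0 mulr0 subrr.
by rewrite big_ord_recr /= mulrDr IH exprS; ring.
Qed.

Let exprB r n : (r <= n)%N -> q ^+ (n - r) = q ^+ n * a ^+ r.
Proof.
move=> rn; rewrite -[in RHS](subnK rn) exprD -mulrA -exprMn.
by rewrite [q * a]mulrC aq expr1n mulr1.
Qed.

(** Substitute r = n - i: the term i = 0 is the isolated [w n], and r = 0 adds nothing because w 0 =
    0. *)
Lemma reversed_weighted_sum n :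
  \sum_(i < n) q ^+ i * w (n - i)%N = q ^+ n * (\sum_(r < n) a ^+ r * w r) + w n.
Proof.
case: n => [|n]; first by rewrite !big_ord0 w0 !mulr0 addr0.
rewrite (reindex_inj rev_ord_inj) /= big_ord_recr /= subnn expr0 mul1r subn0.
rewrite [in RHS]big_ord_recl /= w0 mulr0 add0r; congr (_ + _).
rewrite mulr_sumr; apply: eq_bigr => i _.
have ni : (i < n)%N by [].
by rewrite subKn ?ltnS 1?ltnW// exprB ?ltnS 1?ltnW// /bump /= add1n mulrA.
Qed.

(** Two symmetric families of pairs at distance r contribute [w r] q^r times the sum of q^(2 j) over
    j < n - r, a geometric sum. Keeping 1 - q^2 as a factor, not a divisor, includes q = 1, the case
    of zero drift. The induction adds a last row and a last column, both evaluated by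
    [reversed_weighted_sum]. *)
Lemma weighted_distance_sum n :
  (1 - q ^+ 2) * (\sum_(i < n) \sum_(j < n) q ^+ i * q ^+ j * w (dist i j)) =
  2 * \sum_(r < n) w r * (q ^+ r - q ^+ (2 * n) * a ^+ r).
Proof.
elim: n => [|n IH]; first by rewrite !big_ord0 !mulr0.
rewrite big_ord_recr /=.
under eq_bigr do rewrite big_ord_recr /=.
rewrite big_split /= big_ord_recr /= /dist subnn addn0 w0 mulr0 addr0.
have E1 : \sum_(i < n) q ^+ i * q ^+ n * w (i - n + (n - i))%N =
    q ^+ n * \sum_(i < n) q ^+ i * w (n - i)%N.
  rewrite mulr_sumr; apply: eq_bigr => i _.
  rewrite (_ : (i - n)%N = 0%N) ?add0n; last by apply/eqP; rewrite subn_eq0 ltnW.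
  by rewrite mulrA [q ^+ n * _]mulrC.
have E2 : \sum_(i < n) q ^+ n * q ^+ i * w (n - i + (i - n))%N =
    q ^+ n * \sum_(i < n) q ^+ i * w (n - i)%N.
  rewrite mulr_sumr; apply: eq_bigr => i _.
  rewrite (_ : (i - n)%N = 0%N) ?addn0; last by apply/eqP; rewrite subn_eq0 ltnW.
  by rewrite mulrA.
rewrite E1 E2 !mulrDr {}IH big_ord_recr /= reversed_weighted_sum.
have E3 x : \sum_(r < n) w r * (q ^+ r - x * a ^+ r) =
   \sum_(r < n) w r * q ^+ r - x * \sum_(r < n) a ^+ r * w r.
  by rewrite mulr_sumr -sumrB; apply: eq_bigr => i _; ring.
rewrite !E3 (_ : q ^+ (2 * n.+1) = q ^+ 2 * q ^+ (2 * n)); last first.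
  by rewrite -exprD mulnS.
have qan : q ^+ (2 * n) * a ^+ n = q ^+ n.
  by rewrite -exprB ?leq_pmull// mul2n -addnn addnK.
have -> : q ^+ (2 * n) = q ^+ n * q ^+ n by rewrite mul2n -addnn exprD.
rewrite mul2n -addnn exprD in qan.
have -> : q ^+ 2 * (q ^+ n * q ^+ n) * a ^+ n = q ^+ 2 * q ^+ n by rewrite -mulrA qan.
by ring.
Qed.

(* With q = e^(- theta h), a = 1 / q and w k = (k h)^(2 H), these are the weights
   of B_(i h) in the autoregressive sum with n steps; they are exact increments
   of e^(- theta s) rather than h theta e^(- theta s), which is what makes the
   variance below computable in closed form. *)
Definition ar_coef n i : R := if i == n then 1 else a ^+ n * (1 - q) * q ^+ i.

(** The last factor on the left is the covariance of fractional Brownian motion on a grid. Splitting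
    off index n leaves sums of powers of q, covered by the three preceding identities; what remains
    is an identity of rational functions in q and a^n. The right side is a discrete analogue of
    [fOU_variance]. *)
Lemma ar_variance n :
  \sum_(i < n.+1) \sum_(j < n.+1)
    ar_coef n i * ar_coef n j * (2^-1 * (w i + w j - w (dist i j))) =
  q * a ^+ n * w n +
  q * (1 - q) / (1 + q) * \sum_(r < n) w r * (a ^+ (2 * n) * q ^+ r - a ^+ r).
Proof.
rewrite big_ord_recr /=.
under eq_bigr do rewrite big_ord_recr /=.
rewrite big_split /= big_ord_recr /= /dist subnn addn0 w0 /ar_coef eqxx.
have ne (i : 'I_n) : (i == n :> nat) = false by rewrite ltn_eqF.
pose S1 := \sum_(i < n) q ^+ i * w i.
pose S2 := \sum_(i < n) q ^+ i.
pose S3 := \sum_(i < n) q ^+ i * w (n - i)%N.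
pose D := \sum_(i < n) \sum_(j < n) q ^+ i * q ^+ j * w (dist i j).
pose A := \sum_(r < n) a ^+ r * w r.
have E1 : \sum_(i < n) (if i == n :> nat then 1 else a ^+ n * (1 - q) * q ^+ i) * 1 *
   (2^-1 * (w i + w n - w (i - n + (n - i))%N)) =
   2^-1 * (a ^+ n * (1 - q)) * (S1 + w n * S2 - S3).
  rewrite /S1 /S2 /S3 [w n * _]mulr_sumr -big_split/= -sumrB mulr_sumr.
  apply: eq_bigr => i _; rewrite ne.
  rewrite (_ : (i - n)%N = 0%N) ?add0n; last by apply/eqP; rewrite subn_eq0 ltnW.
  by ring.
have E2 : \sum_(i < n) 1 * (if i == n :> nat then 1 else a ^+ n * (1 - q) * q ^+ i) *
   (2^-1 * (w n + w i - w (n - i + (i - n))%N)) =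
   2^-1 * (a ^+ n * (1 - q)) * (S1 + w n * S2 - S3).
  rewrite -E1; apply: eq_bigr => i _; rewrite ne addnC; ring.
have E3 : \sum_(i < n) \sum_(j < n) (if i == n :> nat then 1 else a ^+ n * (1 - q) * q ^+ i) *
   (if j == n :> nat then 1 else a ^+ n * (1 - q) * q ^+ j) *
   (2^-1 * (w i + w j - w (i - j + (j - i))%N)) =
   (a ^+ n * (1 - q)) ^+ 2 * (S1 * S2 - 2^-1 * D).
  have -> : S1 * S2 - 2^-1 * D = 2^-1 * (S1 * S2 + S2 * S1 - D) by field.
  rewrite /S1 /S2 !big_distrlr /= /D -big_split /= -sumrB !mulr_sumr.
  apply: eq_bigr => i _; rewrite -big_split /= -sumrB !mulr_sumr.
  by apply: eq_bigr => j _; rewrite !ne /dist; ring.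
rewrite E1 E2 E3.
have gs := geometric_sum n; rewrite -/S2 in gs.
have rs := reversed_weighted_sum n; rewrite -/S3 -/A in rs.
have ds := weighted_distance_sum n; rewrite -/D in ds.
have E4 : \sum_(r < n) w r * (q ^+ r - q ^+ (2 * n) * a ^+ r) = S1 - q ^+ (2 * n) * A.
  by rewrite /S1 /A mulr_sumr -sumrB; apply: eq_bigr => i _; ring.
have E5 : \sum_(r < n) w r * (a ^+ (2 * n) * q ^+ r - a ^+ r) = a ^+ (2 * n) * S1 - A.
  by rewrite /S1 /A mulr_sumr -sumrB; apply: eq_bigr => i _; ring.
have aqn : a ^+ n * q ^+ n = 1 by rewrite -exprMn aq expr1n.
rewrite E4 in ds; rewrite E5.
have a2n : a ^+ (2 * n) = a ^+ n * a ^+ n by rewrite mul2n -addnn exprD.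
have q2n : q ^+ (2 * n) = q ^+ n * q ^+ n by rewrite mul2n -addnn exprD.
rewrite {}a2n; rewrite {}q2n in ds.
move: (a ^+ n) (q ^+ n) aqn gs rs ds => x y xy gs rs ds.
(* [D] enters the variance with the factor (1 - q)^2, whereas [ds] evaluates (1 - q^2) D; the
   quotient (1 - q) / (1 + q) requires 1 + q != 0. *)
have D2 : (1 - q) ^+ 2 * D = (1 - q) / (1 + q) * (2 * (S1 - y * y * A)).
  by rewrite -ds; field.
have -> : (x * (1 - q)) ^+ 2 * (S1 * S2 - 2^-1 * D) =
  x ^+ 2 * ((1 - q) * S1 * ((1 - q) * S2) - 2^-1 * ((1 - q) ^+ 2 * D)) by ring.
rewrite D2 gs.
have -> : 2^-1 * (x * (1 - q)) * (S1 + w n * S2 - S3) =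
  2^-1 * x * ((1 - q) * S1 + w n * ((1 - q) * S2) - (1 - q) * S3) by ring.
rewrite gs rs.
have x0 : x != 0 by apply: contra_eq_neq xy => ->; rewrite mul0r eq_sym oner_eq0.
have -> : y = x^-1 by rewrite -[LHS](mulKf x0) xy mulr1.
by field; rewrite x0 q1.
Qed.
End discrete_variance.

(** * Limits of exponentially weighted sums *)

Section exponential_weights.
Variable R : realType.
Implicit Types (f : R -> R) (t x th p : R).

(** The absolute value makes the power continuous on the whole line, the form of continuity that the
    Riemann sum lemmas ask for. *)
Lemma continuous_norm_powR p : 0 < p -> continuous (fun x : R => `|x| `^ p).
Proof.
move=> p0 x; have [->|x0] := eqVneq x 0.
  rewrite /continuous_at normr0 powR0 ?gt_eqF//; apply/cvgrPdist_lt => e e0.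
  exists (e `^ p^-1) => /=; first exact: powR_gt0.
  move=> y /=; rewrite sub0r normrN => ye.
  rewrite sub0r normrN ger0_norm ?powR_ge0//.
  rewrite -[e]powRr1 ?ltW// -(mulVf (lt0r_neq0 p0)) powRrM.
  apply: gt0_ltr_powR; rewrite ?nnegrE// ?powR_ge0//.
apply: (@continuous_comp _ _ _ (fun x : R => `|x|) (fun x => x `^ p)).
  exact: norm_continuous.
apply: differentiable_continuous; apply/derivable1_diffP.
by apply: derivable_powR; rewrite in_itv/= andbT normr_gt0.
Qed.

Lemma step_cvg0 t : t / n.+1%:R @[n --> \oo] --> (0 : R).
Proof.
rewrite -[X in _ --> X](mulr0 t); apply: cvgM; first exact: cvg_cst.
exact: cvg_harmonic.
Qed.

Lemma expR_step_cvg1 th t : expR (th * (t / n.+1%:R)) @[n --> \oo] --> (1 : R).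
Proof.
rewrite -[X in _ --> X]expR0 -[X in expR X](mulr0 th).
apply: continuous_cvg; first exact: continuous_expR.
by apply: cvgM; [exact: cvg_cst|exact: step_cvg0].
Qed.

(** With h the step, the bound 1 + u <= e^u at u = th h and at u = - th h squeezes the quotient
    between th e^(- th h) and th. *)
Lemma one_minus_expR_step_cvg th t : 0 < t ->
  (1 - expR (- th * (t / n.+1%:R))) / (t / n.+1%:R) @[n --> \oo] --> th.
Proof.
move=> t0.
apply: (@squeeze_cvgr _ _ _ _ (fun n => th * expR (- th * (t / n.+1%:R))) (fun=> th)).
- near=> n; set h := t / _.
  have h0 : 0 < h by rewrite divr_gt0// ltr0n.
  apply/andP; split.
    rewrite ler_pdivlMr// mulrAC.
    have := expR_ge1Dx (th * h).
    rewrite -(ler_pM2r (expR_gt0 (- th * h))) -expRD mulNr subrr expR0; lra.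
  rewrite ler_pdivrMr//; have := expR_ge1Dx (- th * h); lra.
- rewrite -[X in _ --> X]mulr1; apply: cvgM; first exact: cvg_cst.
  exact: expR_step_cvg1.
- exact: cvg_cst.
Unshelve. all: by end_near. Qed.

Lemma weighted_riemann_sum_cvg f th t : continuous f -> 0 < t ->
  (1 - expR (- th * (t / n.+1%:R))) * \sum_(i < n.+1) f (i%:R * (t / n.+1%:R))
    @[n --> \oo] --> th * \int[lebesgue_measure]_(s in `[0, t]) f s.
Proof.
move=> cf t0.
under eq_cvg.
  move=> n; rewrite (_ : _ * _ = (1 - expR (- th * (t / n.+1%:R))) / (t / n.+1%:R) *
    (\sum_(i < n.+1) (t / n.+1%:R) * f (i%:R * (t / n.+1%:R)))); last first.
    rewrite -mulr_sumr [RHS]mulrA divfK// gt_eqF// divr_gt0//.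
  over.
by apply: cvgM; [exact: one_minus_expR_step_cvg|exact: riemann_sum_cvg].
Qed.

End exponential_weights.

(** * Moments of finite linear combinations *)

Section linear_combination.
Context d (T : measurableType d) (R : realType) (P : probability T R).

(** A covariance formula provides only the value of an expectation; for a square, finiteness of that
    value is square integrability. *)
Lemma Lfun2_of_expectation_sqr (X : {RV P >-> R}) (r : R) :
  'E_P[(fun w => X w * X w)%R]%E = r%:E -> (X : T -> R) \in Lfun P 2%:E.
Proof.
move=> EX; rewrite inE; apply/andP; split; first by rewrite inE; exact: (measurable_funPT X).
rewrite inE /= /finite_norm unlock /Lnorm poweR_lty//.
move: EX; rewrite unlock => EX.
under eq_integral => w _.
  rewrite /= (_ : `|X w| `^ 2 = X w * X w); last by rewrite powR_mulrn// real_normK ?num_real.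
  over.
by rewrite EX ltry.
Qed.

Lemma expectation_sum_ord n (F : 'I_n -> T -> R) (e : 'I_n -> R) :
  (forall i, F i \in Lfun P 1) -> (forall i, 'E_P[F i]%E = (e i)%:E) ->
  'E_P[(fun w => \sum_(i < n) F i w)%R]%E = (\sum_(i < n) e i)%:E.
Proof.
move=> F1 FE; rewrite unlock.
under eq_integral do rewrite -sumEFin.
rewrite integral_sum//; last by move=> i; exact/Lfun1_integrable.
rewrite -sumEFin; apply: eq_bigr => i _.
by rewrite -FE unlock.
Qed.

Variables (n : nat) (X : 'I_n -> {RV P >-> R}) (c : 'I_n -> R) (k : 'I_n -> 'I_n -> R).
Hypothesis EX : forall i, 'E_P[X i]%E = 0%E.
Hypothesis EXX : forall i j, 'E_P[(fun w => X i w * X j w)%R]%E = (k i j)%:E.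

Let lin w := \sum_(i < n) c i * X i w.

Let X2 i : (X i : T -> R) \in Lfun P 2%:E.
Proof. exact: (Lfun2_of_expectation_sqr _ _ (EXX i i)). Qed.

Lemma measurable_linear_combination : measurable_fun setT lin.
Proof. by apply: measurable_sum => i; exact: measurable_funM. Qed.

Lemma Lfun2_linear_combination : lin \in Lfun P 2%:E.
Proof.
have p12 : (1 <= 2%:E :> \bar R)%E by rewrite lee_fin ler1n.
rewrite (_ : lin = \sum_(i < n) (c i \*: (X i : T -> R))).
  by apply: rpred_sum => i _; apply: rpredZ.
by apply/funext => w; rewrite fct_sumE.
Qed.

Lemma expectation_linear_combination : 'E_P[lin]%E = 0%E.
Proof.
have X1 i : (X i : T -> R) \in Lfun P 1.
  by apply: Lfun_subset12 (X2 i); rewrite fin_num_measure.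
rewrite (@expectation_sum_ord n (fun i w => c i * X i w) (fun=> 0)).
- by rewrite big1.
- by move=> i; exact: (rpredZ (c i) (X1 i)).
- move=> i; rewrite -[RHS](mule0 (c i)%:E) -(EX i) -expectationZl//.
  by congr expectation; apply/funext => w /=; rewrite mulrC.
Qed.

Lemma expectation_sqr_linear_combination :
  'E_P[(fun w => lin w ^+ 2)%R]%E =
  (\sum_(i < n) \sum_(j < n) c i * c j * k i j)%:E.
Proof.
have XX i j : (fun w => c i * c j * (X i w * X j w)) \in Lfun P 1.
  exact: (rpredZ (c i * c j) (Lfun2_mul_Lfun1 (X2 i) (X2 j))).
rewrite (_ : (fun w => lin w ^+ 2) =
    (fun w => \sum_(i < n) \sum_(j < n) c i * c j * (X i w * X j w))); last first.
  apply/funext => w; rewrite expr2 /lin big_distrlr /=.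
  by apply: eq_bigr => i _; apply: eq_bigr => j _; ring.
apply: (@expectation_sum_ord n (fun i w => \sum_(j < n) c i * c j * (X i w * X j w))).
  move=> i; rewrite (_ : (fun w => _) = \sum_(j < n) (fun w => c i * c j * (X i w * X j w))).
    exact: rpred_sum.
  by apply/funext => w; rewrite fct_sumE.
move=> i; apply: (@expectation_sum_ord n (fun j w => c i * c j * (X i w * X j w))) => // j.
rewrite EFinM -EXX.
have <- := expectationZl (c i * c j) (Lfun2_mul_Lfun1 (X2 i) (X2 j)).
by congr expectation; apply/funext => w /=; rewrite mulrC.
Qed.

End linear_combination.

(** * Law of the fractional Ornstein-Uhlenbeck process *)

Section fbm_law.
Context d (T : measurableType d) (R : realType) (P : probability T R).
Variables (H : R) (B : R -> {RV P >-> R}).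
Hypotheses (H0 : 0 < H) (hB : fractional_brownian_motion P H B).

(* Evaluating [B] at [`|s|] extends the path to a continuous function on the
   whole line, to which [weighted_riemann_sum_cvg] applies. *)
Lemma fbm_norm_continuous w : continuous (fun s : R => B `|s| w).
Proof.
move=> s; have /subspace_continuousP/(_ `|s|) := @fbm_continuous _ _ _ _ _ _ hB w.
rewrite /= in_itv /= andbT normr_ge0 => /(_ isT) c.
apply: cvg_trans c.
apply: (@cvg_comp _ _ _ (fun s : R => `|s|) (fun u => B u w)); last exact: cvg_id.
move=> A; rewrite /within /= => A'.
have h : \forall u \near s, (`|u| \in `[0, +oo[%R -> A `|u|) := @norm_continuous _ R s _ A'.
change (\forall u \near s, A `|u|).
by apply: filterS h => u; apply; rewrite in_itv /= andbT.
Qed.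

Lemma fbm_exponential_integral_cdf (th t x V : R) (Y : {RV P >-> R}) : 0 < t ->
  (forall w, Y w = B t w +
     expR (th * t) * (th * \int[lebesgue_measure]_(s in `[0, t]) (expR (- th * s) * B `|s| w))) ->
  V = expR (th * t) * t `^ (2 * H) + th / 2 *
    \int[lebesgue_measure]_(s in `[0, t])
      (`|s| `^ (2 * H) * (expR (th * (2 * t - s)) - expR (th * s))) ->
  0 < V ->
  P [set w | Y w < x] = (Phi (x / Num.sqrt V))%:E /\
  P [set w | Y w <= x] = (Phi (x / Num.sqrt V))%:E.
Proof.
move=> t0 YE VE V0.
have p0 : 0 < 2 * H by rewrite mulr_gt0.
pose h n : R := t / n.+1%:R.
pose q n : R := expR (- th * h n).
pose a n : R := expR (th * h n).
have h0 n : 0 < h n by rewrite divr_gt0// ltr0n.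
have Nh n : n.+1%:R * h n = t by rewrite /h mulrC divfK.
have aq n : a n * q n = 1 by rewrite -expRD mulNr subrr expR0.
have q1 n : 1 + q n != 0 by rewrite gt_eqF// addr_gt0// expR_gt0.
pose w_ n k : R := (k%:R * h n) `^ (2 * H).
have w0 n : w_ n 0%N = 0 by rewrite /w_ mul0r powR0// gt_eqF.
(* There are n + 1 steps of length t / (n + 1), hence n + 2 grid points; the last one has
   coefficient 1 and supplies B_t. *)
pose Y_ n w := \sum_(i < n.+2) ar_coef _ (q n) (a n) n.+1 i * B (i%:R * h n) w.
have mY n : measurable_fun setT (Y_ n) by exact: measurable_linear_combination.
pose Yn n : {RV P >-> R} := HB.pack (Y_ n) (isMeasurableFun.Build _ _ _ _ _ (mY n)).
pose Vn n := q n * (a n) ^+ n.+1 * w_ n n.+1 +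
  q n * (1 - q n) / (1 + q n) *
    \sum_(r < n.+1) w_ n r * ((a n) ^+ (2 * n.+1) * (q n) ^+ r - (a n) ^+ r).
pose f s : R := `|s| `^ (2 * H) * (expR (th * (2 * t - s)) - expR (th * s)).
have ih n (i : nat) : 0 <= i%:R * h n by rewrite mulr_ge0// ltW.
have EB n (i : 'I_n.+2) : 'E_P[B (i%:R * h n)]%E = 0%E by rewrite (fbm_centered hB).
have EBB n (i j : 'I_n.+2) : 'E_P[(fun w => B (i%:R * h n) w * B (j%:R * h n) w)%R]%E =
   (2^-1 * (w_ n i + w_ n j - w_ n (i - j + (j - i))%N))%:E.
  have E : `|i%:R * h n - j%:R * h n| = (i - j + (j - i))%N%:R * h n.
    rewrite -mulrBl normrM (gtr0_norm (h0 n)); congr (_ * _).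
    have [ij|/ltnW ji] := leqP i j.
      by rewrite (eqP ij) add0n natrB// distrC ger0_norm// subr_ge0 ler_nat.
    by rewrite (eqP ji) addn0 natrB// ger0_norm// subr_ge0 ler_nat.
  have := fbm_covariance hB (ih n i) (ih n j).
  by rewrite (ger0_norm (ih n i)) (ger0_norm (ih n j)) E => ->.
apply: (@gaussian_limit _ _ _ _ Yn Y Vn V x) => //.
- move=> w; rewrite YE /=.
  have -> : (fun n => Y_ n w) = (fun n => B t w + expR (th * t) *
     ((1 - expR (- th * (t / n.+1%:R))) *
     \sum_(i < n.+1) (fun s => expR (- th * s) * B `|s| w) (i%:R * (t / n.+1%:R)))).
    apply/funext => n; rewrite /Y_ big_ord_recr /= /ar_coef eqxx mul1r Nh addrC; congr (_ + _).
    rewrite mulr_sumr mulr_sumr; apply: eq_bigr => i _.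
    rewrite (ltn_eqF (ltn_ord i)) -/(h n) (ger0_norm (ih _ _)) -/(q n).
    rewrite /a -expRM_natl mulrCA Nh.
    rewrite (_ : - th * (i%:R * h n) = i%:R * (- th * h n)) ?expRM_natl -/(q n); last by ring.
    by rewrite !mulrA.
  apply: cvgD; first exact: cvg_cst.
  apply: cvgM; first exact: cvg_cst.
  apply: (@weighted_riemann_sum_cvg R (fun s => expR (- th * s) * B `|s| w) th t) => //.
  move=> s; apply: cvgM; last exact: fbm_norm_continuous.
  apply: continuous_cvg; first exact: continuous_expR.
  by apply: cvgM; [exact: cvg_cst|exact: cvg_id].
- move=> n y Vn0; apply: gaussian_law_cdf => //=.
  + exact: (fbm_gaussian hB).
  + exact: Lfun2_linear_combination (EBB n).
  + exact: expectation_linear_combination (EB n) (EBB n).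
  + rewrite (expectation_sqr_linear_combination _ _ _ _ _ _ _ _ (EBB n)).
    by rewrite (ar_variance _ _ _ _ (aq n) (q1 n) (w0 n)).
- have -> : Vn = (fun n => expR (- th * (t / n.+1%:R)) * (expR (th * t) * t `^ (2 * H)) +
    expR (- th * (t / n.+1%:R)) / (1 + expR (- th * (t / n.+1%:R))) *
     ((1 - expR (- th * (t / n.+1%:R))) *
     \sum_(i < n.+1) f (i%:R * (t / n.+1%:R)))).
    apply/funext => n; rewrite /Vn -/(h n) -/(q n).
    have aN : a n ^+ n.+1 = expR (th * t) by rewrite /a -expRM_natl mulrCA Nh.
    rewrite aN /w_ Nh mulrA; congr (_ + _).
    rewrite [RHS]mulrA; congr (_ * _); first by rewrite mulrAC.
    apply: eq_bigr => i _; rewrite /f (ger0_norm (ih _ _)); congr (_ * (_ - _)).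
      rewrite mul2n -addnn exprD aN /q -expRM_natl -!expRD; congr expR; ring.
    by rewrite /a -expRM_natl; congr expR; ring.
  have qc : expR (- th * (t / n.+1%:R)) @[n --> \oo] --> (1 : R) by exact: expR_step_cvg1.
  rewrite VE -[X in X + _]mul1r.
  apply: cvgD; first by apply: cvgM => //; exact: cvg_cst.
  (* The prefactor q / (1 + q) tends to 1 / 2. *)
  rewrite (_ : th / 2 * _ = 1 / (1 + 1) * (th * \int[lebesgue_measure]_(s in `[0, t])
   (`|s| `^ (2 * H) * (expR (th * (2 * t - s)) - expR (th * s))))); last by field.
  apply: cvgM.
    apply: cvgM => //; apply: cvgV; first by rewrite gt_eqF.
    by apply: cvgD => //; exact: cvg_cst.
  apply: (@weighted_riemann_sum_cvg R f) => //.
  move=> s; apply: cvgM; first exact: continuous_norm_powR.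
  apply: cvgB.
    apply: continuous_cvg; first exact: continuous_expR.
    apply: cvgM; first exact: cvg_cst.
    by apply: cvgB; [exact: cvg_cst|exact: cvg_id].
  apply: continuous_cvg; first exact: continuous_expR.
  by apply: cvgM; [exact: cvg_cst|exact: cvg_id].
Qed.
End fbm_law.

(** * The variance function v: integration by parts and bounds *)

Section improper_by_parts.
Variable R : realType.
Implicit Types (f G : R -> R) (t x th p H : R).

(* For H < 1/2 the integrand of [v] is unbounded near 0, so that
   [continuous_FTC2] only applies on [t / n.+2, t]. *)
Lemma ge0_FTC2_oc f G t : 0 < t ->
  (forall x, 0 < x -> {for x, continuous f}) -> (forall x, 0 < x -> 0 <= f x) ->
  (forall x, 0 < x -> is_derive x 1 G (f x)) -> G x @[x --> 0^'+] --> G 0 ->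
  (\int[lebesgue_measure]_(x in `[0%R, t]) (f x)%:E = (G t - G 0)%:E)%E.
Proof.
move=> t0 cf f0 dG G0.
have mf : measurable_fun `]0, t] f.
  have mf' : measurable_fun (`]0, +oo[%classic : set R) f.
    apply: open_continuous_measurable_fun; first exact: interval_open.
    by move=> x; rewrite inE/= in_itv/= andbT; exact: cf.
  apply: measurable_funS mf' => //.
  by move=> x /=; rewrite !in_itv/= => /andP[->].
rewrite -integral_itv_obnd_cbnd; last exact/measurable_EFinP.
have e0 n : 0 < t / n.+2%:R by rewrite divr_gt0.
have et n : t / n.+2%:R < t by rewrite gtr_pMr// invf_lt1// ltr1n.
have UE : `]0, t]%classic = \bigcup_n `[t / n.+2%:R, t]%classic.
  apply/seteqP; split => x /=.
    rewrite in_itv/= => /andP[x0 xt].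
    exists (Num.truncn (t / x)) => //=; rewrite in_itv/= xt andbT.
    rewrite ler_pdivrMr// mulrC -ler_pdivrMr//.
    apply/ltW/(lt_le_trans (truncnS_gt _)); by rewrite ler_nat.
  by move=> [n _] /=; rewrite !in_itv/= => /andP[nx ->]; rewrite (lt_le_trans _ nx).
have key (n : nat) : (\int[lebesgue_measure]_(x in `[(t / n.+2%:R)%R, t]) (f x)%:E =
    (G t - G (t / n.+2%:R))%:E)%E.
  have cG x : 0 < x -> {for x, continuous G}.
    move=> x0; apply: differentiable_continuous; apply/derivable1_diffP.
    by case: (dG x x0).
  rewrite EFinB; apply: continuous_FTC2 => //.
  - apply: continuous_in_subspaceT => x; rewrite inE/= in_itv/= => /andP[ex _].
    exact/cf/(lt_le_trans _ ex).
  - split.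
    + move=> x; rewrite in_itv/= => /andP[ex _].
      by case: (dG x (lt_trans (e0 n) ex)).
    + by apply: cvg_at_right_filter; exact: cG.
    + by apply: cvg_at_left_filter; exact: cG.
  - move=> x; rewrite in_itv/= => /andP[ex _].
    by rewrite derive1E; have := dG x (lt_trans (e0 n) ex) => dx; rewrite derive_val.
rewrite UE.
have := @ge0_nondecreasing_set_cvg_integral _ (measurableTypeR R) R
  (fun n => `[t / n.+2%:R, t]%classic) (EFin \o f) lebesgue_measure.
move=> /(_ _ _ _ _)/cvg_lim <-//.
- apply/cvg_lim => //.
  under eq_fun do rewrite key.
  apply: cvg_EFin; first exact: nearW.
  apply: cvgB; first exact: cvg_cst.
  have := (cvg_at_rightP _ _ _).1 G0 (fun n => t / n.+2%:R).
  apply; split => //.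
  have := @step_cvg0 R t.
  by rewrite -(cvg_shiftS (fun n => t / n.+1%:R)).
- move=> m n mn; apply/subsetPset => x /=; rewrite !in_itv/= => /andP[mx ->].
  rewrite andbT (le_trans _ mx)// ler_pM2l// lef_pV2 ?posrE//.
  by rewrite ler_nat.
- move=> n; apply/measurable_EFinP; apply: measurable_funS mf => //.
  by move=> x /=; rewrite !in_itv/= => /andP[nx ->]; rewrite (lt_le_trans _ nx).
- move=> n x /=; rewrite in_itv/= => /andP[nx _]; rewrite lee_fin f0//.
  exact: lt_le_trans nx.
Qed.
Let h th t s : R := expR (th * s) + expR (th * (2 * t - s)).

Let is_derive_expR_affine a b x :
  is_derive x 1 (fun s : R => expR (a * s + b)) (a * expR (a * x + b)).
Proof.
have d : is_derive x 1 (fun s : R => a * s + b) a.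
  apply: is_derive_eq
    (is_deriveD (is_deriveZ a (is_derive_id x (1:R))) (is_derive_cst b x (1:R))) _.
  by rewrite /GRing.scale /= mulr1 addr0.
by have := is_derive1_comp (is_derive_expR _) d; rewrite mulrC.
Qed.

Let is_derive_h th t x : is_derive x 1 (h th t) (th * expR (th * x) - th * expR (th * (2 * t - x))).
Proof.
have d1 := is_derive_expR_affine th 0 x.
have d2 := is_derive_expR_affine (- th) (th * (2 * t)) x.
have -> : h th t = (fun s : R => expR (th * s + 0)) + (fun s : R => expR (- th * s + th * (2 * t))).
  apply/funext => s.
    change (expR (th * s) + expR (th * (2 * t - s)) =
      expR (th * s + 0) + expR (- th * s + th * (2 * t))).
    by rewrite addr0; congr (_ + expR _); ring.
apply: is_derive_eq (is_deriveD d1 d2) _.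
by rewrite addr0 (_ : th * (2 * t - x) = - th * x + th * (2 * t)) ?mulNr//; ring.
Qed.

Let continuous_h th t : continuous (h th t).
Proof.
by move=> x; apply: differentiable_continuous; apply/derivable1_diffP; case: (is_derive_h th t x).
Qed.

Let is_derive_powR p x : 0 < x -> is_derive x 1 (fun s : R => s `^ p) (p * x `^ (p - 1)).
Proof.
move=> x0; have xi : x \in `]0, +oo[ by rewrite in_itv/= andbT.
apply: DeriveDef; first exact: derivable_powR.
by rewrite -derive1E powR_derive1.
Qed.

Let continuous_powR_gt0 p x : 0 < x -> {for x, continuous (fun s : R => s `^ p)}.
Proof.
move=> x0; apply: differentiable_continuous; apply/derivable1_diffP.
by case: (is_derive_powR p x x0).
Qed.

Let continuous_diff_exp p th t : 0 < p ->
  continuous (fun s : R => `|s| `^ p * (expR (th * (2 * t - s)) - expR (th * s))).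
Proof.
move=> p0 x; apply: cvgM; first exact: continuous_norm_powR.
apply: cvgB; (apply: continuous_cvg; first exact: continuous_expR).
  apply: cvgM; first exact: cvg_cst.
  by apply: cvgB; [exact: cvg_cst|exact: cvg_id].
by apply: cvgM; [exact: cvg_cst|exact: cvg_id].
Qed.

(** This is [v] after integration by parts: s^(2 H - 1) has become s^(2 H), the integrand is
    continuous for H > 0, and the formula is the one reached by the discrete variances. *)
Definition fOU_variance H th t : R := expR (th * t) * t `^ (2 * H) + th / 2 *
  \int[lebesgue_measure]_(s in `[0, t])
    (`|s| `^ (2 * H) * (expR (th * (2 * t - s)) - expR (th * s))).

Lemma integral_v H th t : 0 < H -> 0 < t ->
  (\int[lebesgue_measure]_(s in `[0%R, t])
    (s `^ (2 * H - 1) * (expR (th * s) + expR (th * (2 * t - s))))%:E =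
   (H^-1 * fOU_variance H th t)%:E)%E.
Proof.
move=> H0 t0.
have p0 : 0 < 2 * H by rewrite mulr_gt0.
pose D s : R := `|s| `^ (2 * H) * (expR (th * (2 * t - s)) - expR (th * s)).
have cD : continuous D by exact: continuous_diff_exp.
pose I y := \int[lebesgue_measure]_(s in `[0, y]) D s.
(* Boundary term plus primitive of the remainder: in the derivative, th D cancels s^(2 H) times the
   derivative of [h]. *)
pose G : R -> R := (2 * H)^-1 *: ((fun s : R => s `^ (2 * H)) * h th t + th *: I).
have GE x : G x = (2 * H)^-1 * (x `^ (2 * H) * h th t x + th * I x) by [].
have G0 : G 0 = 0.
  by rewrite GE /I set_itv1 Rintegral_set1 powR0 ?gt_eqF// mul0r mulr0 addr0 mulr0.
have Gt : G t = H^-1 * fOU_variance H th t.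
  rewrite GE /fOU_variance -/(I t) /h (_ : 2 * t - t = t); last by ring.
  by field; rewrite gt_eqF.
transitivity (G t - G 0)%:E; last by rewrite G0 subr0 Gt.
apply: (@ge0_FTC2_oc (fun s => s `^ (2 * H - 1) * h th t s) G t t0).
- by move=> x x0; apply: cvgM; [exact: continuous_powR_gt0|exact: continuous_h].
- by move=> x x0; rewrite mulr_ge0 ?powR_ge0// addr_ge0 ?expR_ge0.
- move=> x x0.
  have d1 := is_deriveM (is_derive_powR (2 * H) x x0) (is_derive_h th t x).
  have d2 := is_deriveZ th (is_derive_primitive _ D x cD x0).
  apply: is_derive_eq (is_deriveZ (2 * H)^-1 (is_deriveD d1 d2)) _.
  by rewrite /GRing.scale /= /D ger0_norm ?ltW//; field; rewrite gt_eqF.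
- rewrite G0 [X in _ --> X](_ : 0 = (2 * H)^-1 * (0 * h th t 0 + th * 0)); last by ring.
  apply: cvgM; first exact: cvg_cst.
  apply: cvgD.
    apply: cvgM; first exact: powR_cvg0.
    by apply: cvg_at_right_filter; exact: continuous_h.
  apply: cvgM; first exact: cvg_cst.
  have /(continuous_within_itvP _ t0)[_ + _] := continuous_primitive _ D t cD (ltW t0).
  by rewrite set_itv1 Rintegral_set1.
Qed.

Lemma integrable_v H th t : 0 < H -> 0 < t ->
  lebesgue_measure.-integrable `[0, t] (EFin \o
    (fun s => s `^ (2 * H - 1) * (expR (th * s) + expR (th * (2 * t - s))))).
Proof.
move=> H0 t0; apply/integrableP; split.
  apply/measurable_EFinP; apply: measurable_funM.
    by apply: measurable_funTS; exact: measurable_powR.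
  by apply: measurable_funTS; apply: continuous_measurable_fun; exact: continuous_h.
under eq_integral => s _.
  rewrite gee0_abs; last by rewrite lee_fin mulr_ge0 ?powR_ge0// addr_ge0 ?expR_ge0.
  over.
by rewrite integral_v// ltry.
Qed.

Lemma v_fOU_variance H th t : 0 < H -> 0 < t -> v H th t = fOU_variance H th t.
Proof.
by move=> H0 t0; rewrite /v /Rintegral integral_v//= mulrA divff ?mul1r// gt_eqF.
Qed.

Lemma v_zero_drift H t : 0 < H -> 0 < t -> v H 0 t = t `^ (2 * H).
Proof.
by move=> H0 t0; rewrite v_fOU_variance// /fOU_variance !mul0r expR0 mul1r addr0.
Qed.

(** The weight s^(2 H - 1) is nonnegative, so pointwise inequalities between the exponential factors
    pass to [v]. The constant c allows a lower bound by the zero-drift variance and a comparison of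
    growth rates. *)
Lemma ler_v H th1 th2 t c : 0 < H -> 0 < t ->
  (forall s, 0 <= s <= t -> c * (expR (th1 * s) + expR (th1 * (2 * t - s))) <=
    expR (th2 * s) + expR (th2 * (2 * t - s))) ->
  c * v H th1 t <= v H th2 t.
Proof.
move=> H0 t0 cle; rewrite /v mulrCA ler_pM2l// -RintegralZl//; last exact: integrable_v.
apply: le_Rintegral => //.
- have mD : measurable (`[0, t]%classic : set (measurableTypeR R)) by exact: measurable_itv.
  exact: (integrableZl mD c (integrable_v _ th1 _ H0 t0)).
- exact: integrable_v.
- move=> s /=; rewrite in_itv/= => st.
  by rewrite mulrCA ler_wpM2l ?powR_ge0// cle.
Qed.

Lemma v_ge H th t : 0 < H -> 0 < t -> expR (th * t) * t `^ (2 * H) <= v H th t.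
Proof.
(* AM-GM: e^(theta s) + e^(theta (2 t - s)) >= 2 e^(theta t) *)
move=> H0 t0; rewrite -v_zero_drift//; apply: ler_v => // s _.
rewrite !mul0r expR0.
have -> : th * s = th * s / 2 + th * s / 2 by field.
have -> : th * (2 * t - s) = th * (2 * t - s) / 2 + th * (2 * t - s) / 2 by field.
have -> : th * t = th * s / 2 + th * (2 * t - s) / 2 by field.
rewrite !expRD.
move: (expR _) (expR _) => x y.
by rewrite -subr_ge0 (_ : _ - _ = (x - y) ^+ 2) ?sqr_ge0//; ring.
Qed.

Lemma v_gt0 H th t : 0 < H -> 0 < t -> 0 < v H th t.
Proof.
move=> H0 t0; apply: lt_le_trans (v_ge _ th _ H0 t0).
by rewrite mulr_gt0 ?expR_gt0 ?powR_gt0.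
Qed.

Lemma v_homo H th1 th2 t : 0 < H -> 0 < t -> th1 <= th2 -> v H th1 t <= v H th2 t.
Proof.
move=> H0 t0 th12; rewrite -[leLHS]mul1r; apply: ler_v => // s /andP[s0 st].
rewrite mul1r lerD// ler_expR ler_wpM2r//; lra.
Qed.

(** Both s and 2 t - s are at most 2 t, so raising the drift multiplies the variance by at most e^(2
    (th2 - th1) t). That is the square of the growth of e^(th t), so the mean grows at least as fast
    as the standard deviation. *)
Lemma v_ratio H th1 th2 t : 0 < H -> 0 < t -> th1 <= th2 ->
  expR (- (2 * (th2 - th1) * t)) * v H th2 t <= v H th1 t.
Proof.
move=> H0 t0 th12; apply: ler_v => // s /andP[s0 st].
rewrite mulrDr -!expRD lerD// ler_expR; nra.
Qed.

End improper_by_parts.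

(** * Pathwise solution of the linear integral equation *)

Section linear_ode.
Variable R : realType.

Lemma is_derive_expR_scale (a y : R) : is_derive y 1 (fun s : R => expR (a * s)) (a * expR (a * y)).
Proof.
have d : is_derive y 1 (fun s : R => a * s) a.
  apply: is_derive_eq (is_deriveZ a (is_derive_id y (1:R))) _.
  by rewrite /GRing.scale /= mulr1.
by have := is_derive1_comp (is_derive_expR _) d; rewrite mulrC.
Qed.

Lemma continuous_expR_scale (a : R) : continuous (fun s : R => expR (a * s)).
Proof.
move=> x; apply: continuous_cvg; first exact: continuous_expR.
by apply: cvgM; [exact: cvg_cst|exact: cvg_id].
Qed.

(** The factor a on the left, instead of a division on the right, includes a = 0. *)
Lemma mul_integral_expR (a t : R) : 0 < t ->
  a * \int[lebesgue_measure]_(s in `[0, t]) expR (a * s) = expR (a * t) - 1.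
Proof.
move=> t0; rewrite -RintegralZl//; last first.
  by apply: continuous_integrable_itv; exact: continuous_expR_scale.
rewrite /Rintegral (@continuous_FTC2 R _ (fun s => expR (a * s)))//.
- by rewrite /= mulr0 expR0.
- by apply: continuous_subspaceT => x; apply: cvgM; [exact: cvg_cst|exact: continuous_expR_scale].
- split.
  + by move=> x _; case: (is_derive_expR_scale a x).
  + by apply: cvg_at_right_filter; exact: continuous_expR_scale.
  + by apply: cvg_at_left_filter; exact: continuous_expR_scale.
- by move=> x _; rewrite derive1E; have := is_derive_expR_scale a x => dx; rewrite derive_val.
Qed.

Variables (x b : R -> R) (x0 th : R).
Hypothesis xint : forall t, 0 <= t -> lebesgue_measure.-integrable `[0, t] (EFin \o x).
Hypothesis xE : forall t, 0 <= t ->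
  x t = x0 + th * \int[lebesgue_measure]_(s in `[0, t]) x s + b t.
Hypothesis cb : continuous (fun s : R => b `|s|).

Let I y := \int[lebesgue_measure]_(s in `[0, y]) x s.

Let cI (t : R) : 0 < t -> {within `[0, t], continuous I}.
Proof.
by move=> t0; apply: parameterized_integral_continuous; rewrite ?ltW//; exact/xint/ltW.
Qed.

Let cIy (y : R) : 0 < y -> {for y, continuous I}.
Proof.
move=> y0; have y1 : 0 < y + 1 by rewrite addr_gt0.
have /(continuous_within_itvP _ y1)[h _ _] := cI _ y1.
by apply: h; rewrite in_itv/= y0/= ltrDl.
Qed.

(** A bootstrap: x is assumed only integrable, so its primitive is continuous; the equation then
    makes x continuous, which in turn makes the primitive differentiable. *)
Let cx (y : R) : 0 < y -> {for y, continuous x}.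
Proof.
move=> y0.
have E : \forall s \near y, x0 + th * I s + b `|s| = x s.
  near=> s; have s0 : 0 < s by near: s; exact: lt_nbhsr.
  by rewrite xE ?(ltW s0)// ger0_norm ?(ltW s0).
rewrite /prop_for /continuous_at -(nbhs_singleton E).
apply: cvg_trans; first exact: (near_eq_cvg E).
apply: cvgD; last exact: cb.
apply: cvgD; first exact: cvg_cst.
by apply: cvgM; [exact: cvg_cst|exact: cIy].
Unshelve. all: by end_near. Qed.

Let dI (y : R) : 0 < y -> is_derive y 1 I (x y).
Proof.
move=> y0; have yy : y < y + 1 by rewrite ltrDl.
have y1 : 0 <= y + 1 by rewrite addr_ge0// ltW.
have [dF F'E] := continuous_FTC1_closed yy (xint _ y1) y0 (cx _ y0).
by apply: DeriveDef => //; rewrite -derive1E.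
Qed.

(** Integrating factor: e^(- th s) I(s) has derivative e^(- th s) (x0 + b s), free of x. Integrating
    it gives I, and the equation gives x. *)
Lemma linear_ode_solution (t : R) : 0 < t ->
  x t = x0 * expR (th * t) + (b t + expR (th * t) *
    (th * \int[lebesgue_measure]_(s in `[0, t]) (expR (- th * s) * b `|s|))).
Proof.
move=> t0.
pose f (s : R) := expR (- th * s) * (x0 + b `|s|).
pose J : R -> R := (fun s => expR (- th * s)) * I.
have cf : continuous f.
  move=> s; apply: cvgM; first exact: continuous_expR_scale.
  by apply: cvgD; [exact: cvg_cst|exact: cb].
have dJ (y : R) : 0 < y -> is_derive y 1 J (f y).
  move=> y0.
  apply: is_derive_eq (is_deriveM (is_derive_expR_scale (- th) y) (dI _ y0)) _.
  rewrite /GRing.scale /= /f ger0_norm ?(ltW y0)// xE ?(ltW y0)// -/(I y); ring.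
have cJ (y : R) : 0 < y -> {for y, continuous J}.
  by move=> y0; apply: cvgM; [exact: continuous_expR_scale|exact: cIy].
have J0 : J 0 = 0.
  by change (expR (- th * 0) * I 0 = 0); rewrite /I set_itv1 Rintegral_set1 mulr0.
have If : \int[lebesgue_measure]_(s in `[0, t]) f s = J t.
  rewrite /Rintegral (@continuous_FTC2 R _ J)//.
  - by rewrite J0 /= subr0.
  - exact: continuous_subspaceT.
  - split.
    + by move=> y; rewrite in_itv/= => /andP[y0 _]; case: (dJ y y0).
    + rewrite J0 -[X in _ --> X](mulr0 (expR (- th * 0))); apply: cvgM.
        by apply: cvg_at_right_filter; exact: continuous_expR_scale.
      have /(continuous_within_itvP _ t0)[_ + _] := cI _ t0.
      by rewrite {2}/I set_itv1 Rintegral_set1.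
    + by apply: cvg_at_left_filter; exact: cJ.
  - move=> y; rewrite in_itv/= => /andP[y0 _].
    by rewrite derive1E; have := dJ y y0 => dy; rewrite derive_val.
have IE : I t = expR (th * t) * \int[lebesgue_measure]_(s in `[0, t]) f s.
  rewrite If; change (I t = expR (th * t) * (expR (- th * t) * I t)).
  by rewrite mulrA -expRD mulNr subrr expR0 mul1r.
have ifb : lebesgue_measure.-integrable `[0, t] (EFin \o (fun s => expR (- th * s) * b `|s|)).
  apply: continuous_integrable_itv => s.
  by apply: cvgM; [exact: continuous_expR_scale|exact: cb].
have ife : lebesgue_measure.-integrable `[0, t] (EFin \o (fun s => expR (- th * s))).
  by apply: continuous_integrable_itv; exact: continuous_expR_scale.
have fE : \int[lebesgue_measure]_(s in `[0, t]) f s =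
   x0 * \int[lebesgue_measure]_(s in `[0, t]) expR (- th * s) +
   \int[lebesgue_measure]_(s in `[0, t]) (expR (- th * s) * b `|s|).
  rewrite -RintegralZl// -RintegralD//.
    by apply: eq_Rintegral => s _; rewrite /f; ring.
  apply: continuous_integrable_itv => s.
  by apply: cvgM; [exact: cvg_cst|exact: continuous_expR_scale].
rewrite xE ?(ltW t0)// -/(I t) IE fE.
have := mul_integral_expR (- th) _ t0.
set A := \int[lebesgue_measure]_(s in `[0, t]) expR (- th * s).
set D := \int[lebesgue_measure]_(s in `[0, t]) (expR (- th * s) * b `|s|).
move: A D => A D.
have -> : expR (- th * t) = (expR (th * t))^-1 by rewrite mulNr expRN.
have := expR_gt0 (th * t); move: (expR _) => e e0.
move=> hA; have {}hA : th * A = 1 - e^-1 by lra.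
have -> : th * (e * (x0 * A + D)) = e * x0 * (th * A) + th * (e * D) by ring.
by rewrite hA; field; rewrite gt_eqF.
Qed.
End linear_ode.

(** * Distribution of X_t and of its absolute value *)

Section fOU_law.
Context d (T : measurableType d) (R : realType) (P : probability T R).
Variables (H x0 th : R) (B X : R -> {RV P >-> R}).
Hypotheses (H0 : 0 < H) (hB : fractional_brownian_motion P H B)
  (hX : fractional_OU x0 th (fun t w => B t w) (fun t w => X t w)).

(** Strict and weak inequalities are both recorded because the open interval |X_t| < K is the event
    X_t < K minus the event X_t <= - K. *)
Lemma fOU_cdf t x : 0 < t ->
  P [set w | X t w < x] = (Phi ((x - x0 * expR (th * t)) / Num.sqrt (v H th t)))%:E /\
  P [set w | X t w <= x] = (Phi ((x - x0 * expR (th * t)) / Num.sqrt (v H th t)))%:E.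
Proof.
move=> t0.
have mY : measurable_fun setT (fun w => X t w - x0 * expR (th * t)).
  exact: measurable_funB.
pose Y : {RV P >-> R} := HB.pack (fun w => X t w - x0 * expR (th * t))
  (isMeasurableFun.Build _ _ _ _ _ mY).
have YE w : Y w = B t w + expR (th * t) *
    (th * \int[lebesgue_measure]_(s in `[0, t]) (expR (- th * s) * B `|s| w)).
  change (X t w - x0 * expR (th * t) = B t w + expR (th * t) *
    (th * \int[lebesgue_measure]_(s in `[0, t]) (expR (- th * s) * B `|s| w))).
  have := @linear_ode_solution R (fun s => X s w) (fun s => B s w) x0 th
    (fOU_integrable hX w) (fOU_equation hX w) (fbm_norm_continuous _ _ _ _ _ _ hB w) t t0.
  by move=> ->; rewrite addrC addKr.
have VE : v H th t = fOU_variance _ H th t by exact: v_fOU_variance.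
have := fbm_exponential_integral_cdf _ _ _ _ _ _ H0 hB th t
  (x - x0 * expR (th * t)) (v H th t) Y t0 YE VE (v_gt0 _ _ _ _ H0 t0).
rewrite (_ : [set w | Y w < _] = [set w | X t w < x]); last first.
  by apply/seteqP; split => w /=; rewrite ltrBlDr subrK.
rewrite (_ : [set w | Y w <= _] = [set w | X t w <= x])//.
by apply/seteqP; split => w /=; rewrite lerBlDr subrK.
Qed.

Lemma fOU_norm_lt t c : 0 < t ->
  P [set w | `|X t w| < expR (t `^ c)] = (g H th x0 t c)%:E.
Proof.
move=> t0.
set K := expR (t `^ c); have K0 : 0 < K by exact: expR_gt0.
have [XK _] := fOU_cdf t K t0; have [_ XNK] := fOU_cdf t (- K) t0.
have mlt : measurable [set w | X t w < K].
  rewrite (_ : [set w | _] = X t @^-1` `]-oo, K[); first exact: measurable_funPTI.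
  by apply/seteqP; split => w /=; rewrite in_itv/=.
have mle : measurable [set w | X t w <= - K].
  rewrite (_ : [set w | _] = X t @^-1` `]-oo, - K]); first exact: measurable_funPTI.
  by apply/seteqP; split => w /=; rewrite in_itv/=.
have -> : [set w | `|X t w| < K] = [set w | X t w < K] `\` [set w | X t w <= - K].
  apply/seteqP; split => w /=; rewrite ltr_norml.
    by move=> /andP[h1 h2]; split => //; apply/negP; rewrite -ltNge.
  by move=> [h1 /negP]; rewrite -ltNge h1 andbT.
rewrite measureD//; last by rewrite -ge0_fin_numE// fin_num_measure.
rewrite setIidr; last by move=> w /= h; apply: le_lt_trans h _; lra.
transitivity ((Phi ((K - x0 * expR (th * t)) / Num.sqrt (v H th t)))%:E -
  (Phi ((- K - x0 * expR (th * t)) / Num.sqrt (v H th t)))%:E)%E.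
  by congr (_ - _)%E; [exact: XK|exact: XNK].
rewrite -EFinB; congr EFin; rewrite /g -/K.
(* The reflection formula [PhiN] turns the subtracted value into the second summand of [g], minus
   1. *)
rewrite (_ : (- K - x0 * expR (th * t)) / _ = - ((K + x0 * expR (th * t)) / Num.sqrt (v H th t))).
  by rewrite PhiN; ring.
by rewrite -opprD mulNr.
Qed.

End fOU_law.

(** * Power of the test *)

Section test.
Variable R : realType.
Implicit Types (a b x y t c th H : R).

Lemma normal_pdf01_antitone x y : `|x| <= `|y| -> normal_pdf 0 1 y <= normal_pdf 0 1 x :> R.
Proof.
move=> xy; rewrite !normal_pdfE// ler_pM2l ?normal_peak_gt0// ler_expR !subr0.
rewrite ler_pM2r ?invr_gt0 ?pmulrn_lgt0 ?exprn_gt0// lerN2.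
by rewrite -(real_normK (num_real x)) -(real_normK (num_real y)) ler_pXn2r ?nnegrE.
Qed.

(** For a >= 0 and N standard normal, this is P(|N + b| < a). *)
Definition interval_prob a b : R := Phi (a - b) + Phi (a + b) - 1.

Lemma interval_prob_norm a b : interval_prob a `|b| = interval_prob a b.
Proof.
rewrite /interval_prob; have [_|//] := ler0P b.
by rewrite opprK [Phi (a + b) + _]addrC.
Qed.

(** Widening the interval is monotonicity of [Phi]. For the shift, evenness reduces to b >= 0, where
    the derivative f(a + b) - f(a - b) is nonpositive: |a - b| <= a + b and the standard density f
    decreases in the absolute value. *)
Lemma ler_interval_prob a1 b1 a2 b2 : 0 <= a2 -> a2 <= a1 -> `|b1| <= `|b2| ->
  interval_prob a2 b2 <= interval_prob a1 b1.
Proof.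
move=> a20 a21; rewrite -(interval_prob_norm a2) -(interval_prob_norm a1).
move: (normr_ge0 b1) (normr_ge0 b2); move: `|b1| `|b2| => {}b1 {}b2 b10 b20 b12.
apply: (@le_trans _ _ (interval_prob a2 b1)); last first.
  by rewrite /interval_prob lerD2r; apply: lerD; apply: normal_cdf_homo; lra.
have [->//|b12'] := eqVneq b1 b2.
have {b12'}b12' : b1 < b2 by rewrite lt_neqAle b12' b12.
pose F : R -> R := (@Phi R \o (fun y => a2 - y)) + (@Phi R \o (fun y => a2 + y)).
have dF y : is_derive y 1 F (normal_pdf 0 1 (a2 + y) - normal_pdf 0 1 (a2 - y)).
  have d1 : is_derive y 1 (fun y : R => a2 - y) (-1).
    apply: is_derive_eq (is_deriveB (is_derive_cst a2 y (1:R)) (is_derive_id y (1:R))) _.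
    by rewrite sub0r.
  have d2 : is_derive y 1 (fun y : R => a2 + y) 1.
    apply: is_derive_eq (is_deriveD (is_derive_cst a2 y (1:R)) (is_derive_id y (1:R))) _.
    by rewrite add0r.
  have d3 := @is_derive1_comp R (@Phi R) _ y _ _ (is_derive_Phi _ _) d1.
  have d4 := @is_derive1_comp R (@Phi R) _ y _ _ (is_derive_Phi _ _) d2.
  by apply: is_derive_eq (is_deriveD d3 d4) _; ring.
have [|z] := MVT b12' (fun y _ => dF y).
  apply: continuous_subspaceT => y; apply: differentiable_continuous; apply/derivable1_diffP.
  by case: (dF y).
rewrite in_itv/= => /andP[z1 z2] FE.
have FI y : interval_prob a2 y = F y - 1 by [].
rewrite -subr_le0 !FI (_ : _ - _ = F b2 - F b1); last by ring.
rewrite FE mulr_le0_ge0//; last by rewrite subr_ge0 ltW.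
rewrite subr_le0; apply: normal_pdf01_antitone.
have z0 : 0 <= z by lra.
by rewrite [leRHS]ger0_norm ?addr_ge0// ler_norml; apply/andP; split; lra.
Qed.

Lemma g_interval_prob H th x0 t c :
  g H th x0 t c = interval_prob (expR (t `^ c) / Num.sqrt (v H th t))
    (x0 * expR (th * t) / Num.sqrt (v H th t)).
Proof. by rewrite /g /interval_prob mulrBl mulrDl. Qed.

(* Both the threshold and the mean are measured in units of the standard
   deviation: the former decreases and the latter increases with the drift. *)
Lemma g_antitone H th1 th2 x0 t c : 0 < H -> 0 < t -> th1 <= th2 ->
  g H th2 x0 t c <= g H th1 x0 t c.
Proof.
move=> H0 t0 th12; rewrite !g_interval_prob.
have v1 := v_gt0 _ _ th1 _ H0 t0; have v2 := v_gt0 _ _ th2 _ H0 t0.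
have v12 := v_homo _ _ _ _ _ H0 t0 th12.
have v21 := v_ratio _ _ _ _ _ H0 t0 th12.
move: (v H th1 t) (v H th2 t) v1 v2 v12 v21 => u1 u2 u10 u20 u12 u21.
have s1 : 0 < Num.sqrt u1 by rewrite sqrtr_gt0.
have s2 : 0 < Num.sqrt u2 by rewrite sqrtr_gt0.
apply: ler_interval_prob.
- exact: divr_ge0 (expR_ge0 _) (ltW s2).
- by rewrite ler_pM2l ?expR_gt0// lef_pV2 ?posrE// ler_wsqrtr.
rewrite !normrM !normfV ![`|Num.sqrt _|]gtr0_norm// ![`|expR _|]gtr0_norm ?expR_gt0//.
rewrite -!mulrA ler_wpM2l// ler_pdivlMr// mulrAC ler_pdivrMr//.
have E : expR (- (2 * (th2 - th1) * t)) = expR (th1 * t) ^+ 2 / expR (th2 * t) ^+ 2.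
  by rewrite -!expRM_natl -expRN -expRD; congr expR; ring.
rewrite E mulrAC ler_pdivrMr ?exprn_gt0 ?expR_gt0// in u21.
rewrite -ler_sqr ?nnegrE; last 2 first.
- by rewrite mulr_ge0 ?expR_ge0 ?(ltW s2).
- by rewrite mulr_ge0 ?expR_ge0 ?(ltW s1).
by rewrite !exprMn (sqr_sqrtr (ltW u10)) (sqr_sqrtr (ltW u20)) [leRHS]mulrC.
Qed.

Lemma g_mono H th x0 t : 0 < H -> 1 < t -> {mono g H th x0 t : c d / c <= d}.
Proof.
move=> H0 t1; apply: le_mono => c1 c2 c12.
have t0 : 0 < t by lra.
have s0 : 0 < Num.sqrt (v H th t) by rewrite sqrtr_gt0 v_gt0.
have K : expR (t `^ c1) < expR (t `^ c2).
  rewrite ltr_expR /powR gt_eqF// ltr_expR ltr_pM2r// ln_gt0//.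
rewrite /g ltrD2r ltrD// Phi_mono ltr_pM2r ?invr_gt0//; lra.
Qed.

(** Positivity of c makes the truncation harmless: where [lnplus] returns 0 the left side holds, and
    so does the right, since then ln |x| <= 1 < t^c. At x = 0 the value ln 0 = 0 falls in this
    case. *)
Lemma lt_Zstat t x c : 1 < t -> 0 < c -> (Zstat t x < c) = (`|x| < expR (t `^ c)).
Proof.
move=> t1 c0; have lt0 : 0 < ln t by rewrite ln_gt0.
rewrite /Zstat ltr_pdivrMr//.
have -> : t `^ c = expR (c * ln t) by rewrite /powR gt_eqF//; lra.
have L0 : 0 < c * ln t by rewrite mulr_gt0.
have E1 : 1 < expR (c * ln t) by rewrite -expR0 ltr_expR.
move: L0 E1; set L := c * ln t => L0 E1.
have -> : (lnplus (ln `|x|) < L) = (ln `|x| < expR L).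
  rewrite /lnplus; case: ifPn => [y1|]; last first.
    by rewrite -leNgt => y1; rewrite L0 (le_lt_trans y1).
  by rewrite -ltr_expR lnK// posrE; lra.
have [->|xn0] := eqVneq x 0; first by rewrite normr0 ln0// !expR_gt0.
by rewrite -ltr_expR lnK// posrE normr_gt0.
Qed.

(** As [g] is strictly increasing in its last argument and equals alpha at c, rejection means that
    the statistic is below c. *)
Lemma rejection_regionE H th x0 alpha t c : 0 < H -> 1 < t -> 0 < c ->
  g H th x0 t c = alpha ->
  rejection_region H th x0 alpha t = [set x | `|x| < expR (t `^ c)].
Proof.
move=> H0 t1 c0 gc; apply/seteqP; split => x;
  rewrite /rejection_region /acceptance_region /= -gc g_mono//.
  by move=> /negP; rewrite -ltNge lt_Zstat.
by move=> xc; apply/negP; rewrite -ltNge lt_Zstat.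
Qed.

End test.

(** * Consistency *)

Section consistency.
Variable R : realType.

(* Under [theta0] the rejection interval has probability [alpha], so its
   half-width exceeds [delta] standard deviations, and the standard deviation is
   at least exp(theta0 t / 2) t^H. *)
Lemma g_lower_bound (H x0 theta0 alpha delta t c : R) :
  0 < H -> 0 < theta0 -> 1 <= t -> 0 <= delta ->
  2 * Phi delta - 1 < alpha -> g H theta0 x0 t c = alpha ->
  2 * Phi (delta * (1 + theta0 / 2 * t) - `|x0|) - 1 <= g H 0 x0 t c.
Proof.
move=> H0 th0 t1 d0 da gE; have t0 : 0 < t by lra.
set K := expR (t `^ c).
have u0 := v_gt0 _ _ theta0 _ H0 t0.
have uge := v_ge _ _ theta0 _ H0 t0.
have Kd : delta * Num.sqrt (v H theta0 t) < K.
  have s0 : 0 < Num.sqrt (v H theta0 t) by rewrite sqrtr_gt0.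
  rewrite -ltr_pdivlMr// -(Phi_mono R).
  (* Removing the shift can only increase the probability; hence alpha is at most 2 Phi(K / sqrt v)
     - 1, and the choice of delta forces K / sqrt v > delta. *)
  have : g H theta0 x0 t c <= interval_prob _ (K / Num.sqrt (v H theta0 t)) 0.
    rewrite g_interval_prob -/K; apply: ler_interval_prob => //.
      by rewrite divr_ge0 ?expR_ge0// (ltW s0).
    by rewrite normr0.
  rewrite gE /interval_prob subr0 addr0; lra.
have tH1 : 1 <= t `^ H.
  by rewrite -(powRr0 t) ler_powR// ltW.
have sq : Num.sqrt (t `^ (2 * H)) = t `^ H.
  by rewrite mulrC powRrM powR_mulrn ?powR_ge0// sqrtr_sqr ger0_norm ?powR_ge0.
have sge : (1 + theta0 / 2 * t) * t `^ H <= Num.sqrt (v H theta0 t).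
  apply: (@le_trans _ _ (expR (theta0 / 2 * t) * t `^ H)).
    by rewrite ler_wpM2r ?powR_ge0// expR_ge1Dx.
  rewrite -sq -[expR (theta0 / 2 * t)]ger0_norm ?expR_ge0// -sqrtr_sqr -sqrtrM ?sqr_ge0//.
  apply: ler_wsqrtr; rewrite -expRM_natl.
  by rewrite (_ : 2%:R * (theta0 / 2 * t) = theta0 * t)//; field.
rewrite /g -/K v_zero_drift// sq mul0r expR0 mulr1.
have KL : delta * (1 + theta0 / 2 * t) * t `^ H <= K.
  by apply: le_trans (ltW Kd); rewrite -mulrA ler_wpM2l.
(* Since t^H >= 1, dividing the initial value by t^H costs at most |x0|. *)
have x0H : `|x0| <= `|x0| * t `^ H by rewrite ler_peMr.
have PL y : - `|x0| <= y -> Phi (delta * (1 + theta0 / 2 * t) - `|x0|) <= Phi ((K + y) / t `^ H).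
  move=> y0; apply: normal_cdf_homo; rewrite ler_pdivlMr ?powR_gt0//.
  rewrite mulrBl; lra.
have := PL x0; have := PL (- x0).
have h1 : - `|x0| <= - x0 by rewrite lerN2 ler_norm.
have h2 : - `|x0| <= x0 by rewrite lerNl -normrN ler_norm.
by move=> /(_ h1) p1 /(_ h2) p2; lra.
Qed.

Lemma Phi_le1 (x : R) : Phi x <= 1.
Proof.
by rewrite -lee_fin fineK ?fin_num_measure//; exact: probability_le1.
Qed.

(** By continuity of [Phi] at 0, where 2 Phi(0) - 1 = 0. *)
Lemma exists_Phi_small (alpha : R) : 0 < alpha ->
  exists2 delta : R, 0 < delta & 2 * Phi delta - 1 < alpha.
Proof.
move=> a0.
have e0 : 0 < alpha / 2 by rewrite divr_gt0.
have /cvgrPdist_lt /(_ _ e0) [r /= r0 rP] := @continuous_Phi R 0.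
exists (r / 2); first by rewrite divr_gt0.
have := rP (r / 2); rewrite /= sub0r normrN gtr0_norm ?divr_gt0//.
have rr : r / 2 < r by lra.
by move=> /(_ rr); rewrite Phi0 ltr_distlC; lra.
Qed.

Lemma Phi_affine_cvg1 (a b : R) : 0 < a -> 2 * Phi (a * t + b) - 1 @[t --> +oo%R] --> (1 : R).
Proof.
move=> a0; rewrite [X in _ --> X](_ : 1 = 2 * 1 - 1); last by ring.
apply: cvgB; last exact: cvg_cst.
apply: cvgM; first exact: cvg_cst.
apply: (@cvg_comp _ _ _ (fun t : R => a * t + b) (@Phi R) _ (+oo%R)); last exact: normal_cdf_cvgy.
apply: (@cvg_comp _ _ _ (fun t : R => a * t) (fun y => y + b) _ (+oo%R)); last exact: cvg_addrr.
exact: gt0_cvgMry.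
Qed.

End consistency.

Theorem theorem2p10 (R : realType) (d : measure_display) (T : measurableType d)
    (H x0 alpha theta0 : R)
    (hH : 0 < H < 1) (halpha : 0 < alpha < 1) (htheta0 : 0 < theta0 < 1)
    (P : R -> probability T R)
    (B X : forall theta : R, R -> {RV (P theta) >-> R})
    (hX : fOU_model H x0 P B X)
    (t0 : R) (ht0 : 1 < t0) (ctilde : R -> R)
    (hctilde : forall t, t0 < t ->
       unique (fun c => 0 < c < 1 /\ g H theta0 x0 t c = alpha) (ctilde t)) :
  [/\ (forall t, t0 < t ->
         unbiased alpha [set theta | theta0 <= theta] [set theta | theta <= 0]
           (power P X H theta0 x0 alpha t)),
      consistent [set theta | theta <= 0] (power P X H theta0 x0 alpha) &
      (forall theta1 t, theta1 <= 0 -> t0 < t ->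
         power P X H theta0 x0 alpha t theta1 =
           (g H theta1 x0 t (ctilde t))%:E)].
Proof.
have H0 : 0 < H by case/andP: hH.
have [a0 a1] := andP halpha.
have [th0 _] := andP htheta0.
have powE theta t : t0 < t ->
    power P X H theta0 x0 alpha t theta = (g H theta x0 t (ctilde t))%:E.
  move=> tt; have [[/andP[c0 _] gc] _] := hctilde t tt.
  have t1 : 1 < t by exact: lt_trans tt.
  have [hB hOU] := hX theta.
  rewrite /power (rejection_regionE _ _ _ _ _ _ _ H0 t1 c0 gc).
  by apply: (fOU_norm_lt _ _ _ _ _ _ _ _ _ H0 hB hOU); exact: lt_trans t1.
have gc t : t0 < t -> g H theta0 x0 t (ctilde t) = alpha.
  by move=> tt; have [[]] := hctilde t tt.
split.
- move=> t tt; have t_gt0 : 0 < t by lra.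
  (* The threshold [ctilde t] does not depend on theta, so both bounds compare [g] at theta with its
     value alpha at theta0. *)
  split => theta /= hth; rewrite powE// lee_fin -(gc t tt); apply: g_antitone => //.
  exact: le_trans hth (ltW th0).
- move=> theta1 /= hth.
  have [delta d0 da] := exists_Phi_small _ _ a0.
  have L1 := @Phi_affine_cvg1 R (delta * (theta0 / 2)) (delta - `|x0|)
    (mulr_gt0 d0 (divr_gt0 th0 (ltr0n _ 2))).
  apply: cvg_EFin.
    near=> t; rewrite powE//; near: t; apply: nbhs_pinfty_gt; exact: num_real.
  apply: (@squeeze_cvgr _ _ _ _
    (fun t => 2 * Phi (delta * (theta0 / 2) * t + (delta - `|x0|)) - 1) (fun=> 1)) => //;
    last exact: cvg_cst.
  near=> t; have tt : t0 < t by near: t; apply: nbhs_pinfty_gt; exact: num_real.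
  rewrite /= -lee_fin fineK; last by rewrite powE.
  apply/andP; split; last first.
    rewrite powE//= /g lerBlDr; apply: lerD; exact: Phi_le1.
  rewrite powE// lee_fin.
  have t_gt0 : 0 < t by lra.
  have t1 : 1 <= t by lra.
  (* Among the drifts theta1 <= 0 the power is smallest at 0, where the lower bound is available. *)
  apply: le_trans (g_antitone _ _ _ _ _ _ _ H0 t_gt0 hth).
  have := g_lower_bound _ _ _ _ _ _ _ _ H0 th0 t1 (ltW d0) da (gc t tt).
  by rewrite (_ : delta * (1 + theta0 / 2 * t) - `|x0| =
    delta * (theta0 / 2) * t + (delta - `|x0|)); last ring.
- by move=> theta1 t _ tt; exact: powE.
Unshelve. all: by end_near. Qed.
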